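(* Let $k$ be a field with algebraic closure $\bar k$, $G$ a group, $\gamma\in G$, $\chi\colon G\to k^\times$ a group homomorphism, and $c\in Z^1(G,k_\chi)$. Let $\sigma$ be the $k$-algebra automorphism of $kG$ with $\sigma(\tau)=\chi(\tau)\gamma\tau\gamma^{-1}$, let $\delta_c$ be the $k$-linear $\sigma$-derivation with $\delta_c(\tau)=c(\tau)\gamma\tau$ ($\tau\in G$), and let $A=kG[t;\sigma,\delta_c]$, $G$-graded with $\deg t=\gamma$. Put $s=\gamma^{-1}t\in A$, and let $\Phi\colon G\to\mathrm{Aff}(1,k)$, $\tau\mapsto\varphi_\tau$, be the homomorphism with $\varphi_\tau(X)=\chi(\tau)X+c(\tau)$. \begin{enumerate} \item[(1)] The graded ideals of $A$ are the ideals $Af(s)$, where $f=0$ or $f\in k[X]$ is monic with $f\circ\varphi_\tau\in k^\times f$ for all $\tau\in G$. Distinct $f$ give distinct ideals. \item[(2)] $A$ is gr-simple if and only if $\Phi(G)$ has no finite orbit in $\bar k$, if and only if $[c]$ restricts to a nonzero class in $H^1(H,k_\chi)$ for every subgroup $H$ of finite index in $G$. \item[(3)] If $\operatorname{char}k=0$, then $A$ is gr-simple if and only if $[c]\neq0$ in $H^1(G,k_\chi)$. \item[(4)] $A$ is simple if and only if it is gr-simple and $\Phi$ is injective. In particular, if $A$ is simple, then $G$ is metabelian. \end{enumerate}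
   Context: Crossed homomorphisms: $Z^1(G,k_\chi)$ is the $k$-space of maps $c\colon G\to k$ with $c(\tau\rho)=c(\tau)+\chi(\tau)c(\rho)$ for $\tau,\rho\in G$; $B^1(G,k_\chi)$ is the subspace of maps $\tau\mapsto x(\chi(\tau)-1)$ with $x\in k$; $H^1(G,k_\chi)=Z^1/B^1$ and $[c]$ is the class of $c$. For a subgroup $H$, $H^1(H,k_\chi)$ is formed with $\chi|_H$. The group algebra $kG$ is $G$-graded by $(kG)_\tau=k\tau$. For a ring endomorphism $\sigma$ of a ring $R$, a $\sigma$-derivation is an additive map $\delta$ with $\delta(rs)=\delta(r)s+\sigma(r)\delta(s)$; the Ore extension $R[t;\sigma,\delta]$ is the free left $R$-module with basis $1,t,t^2,\dots$ with multiplication determined by $tr=\sigma(r)t+\delta(r)$. Here $\sigma$ and $\delta_c$ are extended $k$-linearly from $G$ to $kG$, and the $G$-grading on $A$ is $A_\alpha=\bigoplus_{n\ge0}(kG)_{\alpha\gamma^{-n}}t^n$ ($\alpha\in G$). An ideal (two-sided) is graded if generated by homogeneous elements; a graded ring is gr-simple if $0$ and the ring itself are its only graded ideals. $\mathrm{Aff}(1,k)$ is the group of maps $X\mapsto aX+b$ with $a\in k^\times$, $b\in k$, under composition; it acts on $\bar k$ by $x\mapsto ax+b$. For $f\in k[X]$, $f\circ\varphi_\tau$ denotes $f(\chi(\tau)X+c(\tau))$. A group is metabelian if it has an abelian normal subgroup with abelian quotient. *)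

(* Defs.v *)
From HB Require Import structures.
From mathcomp Require Import all_boot all_order all_algebra.
From mathcomp Require Import finmap monalg.
From mathcomp Require Import boolp classical_sets functions cardinality.

Set Implicit Arguments.
Unset Strict Implicit.
Unset Printing Implicit Defensive.

Import GRing.Theory.

Local Open Scope classical_set_scope.
Local Open Scope ring_scope.

Section LinearExtension.
Context {K : choiceType} {R : nzRingType} {V : lmodType R}.
Implicit Types (h : K -> V) (g : {malg R[K]}).

(* The R-linear extension of h to {malg R[K]}. *)
Definition mlift h g : V := \sum_(x <- msupp g) g@_x *: h x.

Lemma mlift_wide h g (d : {fset K}) :
  (msupp g `<=` d)%fset -> mlift h g = \sum_(x <- d) g@_x *: h x.
Proof.
move=> le_gd; rewrite /mlift (big_fset_incl _ le_gd) //= => x _.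
by move/mcoeff_outdom ->; rewrite scale0r.
Qed.

Lemma mlift_is_linear h : linear (mlift h).
Proof.
move=> a g1 g2; pose d := (msupp g1 `|` msupp g2)%fset.
have le1 : (msupp g1 `<=` d)%fset by exact: fsubsetUl.
have le2 : (msupp g2 `<=` d)%fset by exact: fsubsetUr.
have le3 : (msupp (a *: g1 + g2) `<=` d)%fset.
  apply: fsubset_trans (msuppD_le _ _) _; apply: fsetSU; exact: msuppZ_le.
rewrite (mlift_wide h le1) (mlift_wide h le2) (mlift_wide h le3).
rewrite scaler_sumr -big_split /=; apply: eq_bigr => x _.
by rewrite mcoeffD mcoeffZ scalerDl scalerA.
Qed.

HB.instance Definition _ h :=
  GRing.isLinear.Build R {malg R[K]} V *:%R (mlift h) (mlift_is_linear h).

Lemma mliftU h a x : mlift h << a *g x >> = a *: h x.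
Proof.
rewrite (mlift_wide h (@msuppU_le _ _ x a)) big_seq_fset1.
by rewrite mcoeffUU.
Qed.

Lemma malg_ext (f1 f2 : {additive {malg R[K]} -> V}) :
  (forall a x, f1 << a *g x >> = f2 << a *g x >>) -> f1 =1 f2.
Proof.
by move=> eq_f g; rewrite (monalgE g) !raddf_sum; apply: eq_bigr.
Qed.

End LinearExtension.

(* monalg makes {malg k[G]} a ring only when the monomials have no nontrivial
   units, which rules out groups; the convolution product is defined here. *)
Definition galg (k : comNzRingType) (G : groupType) := {malg k[G]}.

HB.instance Definition _ (k : comNzRingType) (G : groupType) :=
  GRing.Lmodule.copy (galg k G) {malg k[G]}.

Definition galg_elt (k : comNzRingType) (G : groupType) (x : G) : galg k G :=
  << 1 *g x >>.

HB.lock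
Definition galg_mul (k : comNzRingType) (G : groupType) (u v : galg k G) :
    galg k G :=
  mlift (fun x => mlift (fun y => galg_elt k (x * y)%g) v) u.

Section GroupAlgebra.
Context {k : comNzRingType} {G : groupType}.
Implicit Types u v w : galg k G.
Local Notation galg_mul := (@galg_mul k G).
Local Notation U := (@galg_elt k G).

Lemma galgUE (a : k) (x : G) : << a *g x >> = a *: U x :> galg k G.
Proof.
apply/malgP => y; rewrite [RHS](mcoeffZ a _ y) !mcoeffU.
by rewrite mulrnAr mulr1.
Qed.

Lemma galg_ind (P : galg k G -> Prop) :
  P 0 -> (forall u v, P u -> P v -> P (u + v)) ->
  (forall a x, P (a *: U x)) -> forall u, P u.
Proof.
move=> P0 PD PU u; rewrite (monalgE u).
by elim/big_ind: _ => // x _; rewrite galgUE; exact: PU.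
Qed.

Lemma mlift_galgE (V : lmodType k) (h : G -> V) a x :
  mlift h (a *: U x) = a *: h x.
Proof. by rewrite -galgUE mliftU. Qed.

Lemma galg_mulDl : left_distributive galg_mul +%R.
Proof. by move=> u v w; rewrite !galg_mul.unlock linearD. Qed.

Lemma galg_mulDr : right_distributive galg_mul +%R.
Proof.
move=> u v w; rewrite !galg_mul.unlock /mlift -big_split /=.
apply: eq_bigr => x _.
rewrite -scalerDr; congr (_ *: _).
exact: (linearD (mlift (fun y => U (x * y)%g)) v w).
Qed.

Lemma galg_mulZl a u v : galg_mul (a *: u) v = a *: galg_mul u v.
Proof. by rewrite !galg_mul.unlock linearZ. Qed.

Lemma galg_mulZr a u v : galg_mul u (a *: v) = a *: galg_mul u v.
Proof.
rewrite !galg_mul.unlock {1 3}/mlift scaler_sumr; apply: eq_bigr => x _.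
by rewrite linearZ /= !scalerA mulrC.
Qed.

Lemma galg_mulUU x y : galg_mul (U x) (U y) = U (x * y)%g.
Proof. by rewrite !galg_mul.unlock !mliftU !scale1r. Qed.

Lemma galg_mul0l u : galg_mul 0 u = 0.
Proof. by have := galg_mulZl 0 0 u; rewrite !scale0r. Qed.

Lemma galg_mul0r u : galg_mul u 0 = 0.
Proof. by have := galg_mulZr 0 u 0; rewrite !scale0r. Qed.

Lemma galg_mulA : associative galg_mul.
Proof.
move=> u v w; move: u; apply: galg_ind => [|u1 u2 h1 h2|a x].
- by rewrite !galg_mul0l.
- by rewrite !galg_mulDl h1 h2.
rewrite !galg_mulZl; congr (_ *: _).
move: v; apply: galg_ind => [|v1 v2 h1 h2|b y].
- by rewrite galg_mul0r galg_mul0l galg_mul0r.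
- by rewrite galg_mulDl !galg_mulDr galg_mulDl h1 h2.
rewrite galg_mulZr !galg_mulZl galg_mulZr; congr (_ *: _).
move: w; apply: galg_ind => [|w1 w2 h1 h2|c z].
- by rewrite !galg_mul0r.
- by rewrite !galg_mulDr h1 h2.
by rewrite !galg_mulZr !galg_mulUU mulgA.
Qed.

Lemma galg_mul1l : left_id (U 1%g) galg_mul.
Proof.
apply: galg_ind => [|u v h1 h2|a x]; first by rewrite galg_mul0r.
- by rewrite galg_mulDr h1 h2.
- by rewrite galg_mulZr galg_mulUU mul1g.
Qed.

Lemma galg_mul1r : right_id (U 1%g) galg_mul.
Proof.
apply: galg_ind => [|u v h1 h2|a x]; first by rewrite galg_mul0l.
- by rewrite galg_mulDl h1 h2.
- by rewrite galg_mulZl galg_mulUU mulg1.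
Qed.

Lemma galg_1neq0 : U 1%g != 0.
Proof.
apply/eqP => /malgP/(_ 1%g).
by rewrite mcoeffUU mcoeff0 => /eqP; rewrite oner_eq0.
Qed.

HB.instance Definition _ := GRing.Zmodule_isNzRing.Build (galg k G)
  galg_mulA galg_mul1l galg_mul1r galg_mulDl galg_mulDr galg_1neq0.

HB.instance Definition _ := GRing.Lmodule_isLalgebra.Build k (galg k G)
  (fun a u v => esym (galg_mulZl a u v)).

HB.instance Definition _ := GRing.Lalgebra_isAlgebra.Build k (galg k G)
  (fun a u v => esym (galg_mulZr a u v)).

Lemma galg_eltM x y : U x * U y = U (x * y)%g.
Proof. exact: galg_mulUU. Qed.

Lemma galg_elt1 : U 1%g = 1.
Proof. by []. Qed.

End GroupAlgebra.

Record skew_der (R : nzRingType) (sigma : R -> R) := SkewDer {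
  skew_fun :> {additive R -> R};
  skew_leibniz : forall r s,
    skew_fun (r * s) = skew_fun r * s + sigma r * skew_fun s
}.

(* The Ore extension R[t; sigma, delta]: [Ore p] stands for the left
   combination \sum_i p`_i t^i. *)
Record ore (R : nzRingType) (sigma : {rmorphism R -> R})
  (delta : skew_der sigma) := Ore { ore_poly : {poly R} }.

Arguments Ore {R sigma} delta ore_poly.

(* Left multiplication by t: t a t^j = sigma(a) t^(j+1) + delta(a) t^j. *)
Definition ore_shift (R : nzRingType) (sigma : {rmorphism R -> R})
    (delta : skew_der sigma) (p : {poly R}) : {poly R} :=
  map_poly sigma p * 'X + map_poly delta p.

HB.lock
Definition ore_mulp (R : nzRingType) (sigma : {rmorphism R -> R})
    (delta : skew_der sigma) (p q : {poly R}) : {poly R} :=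
  \sum_(i < size p) p`_i *: iter i (ore_shift delta) q.

Section OreExtension.
Context {R : nzRingType} {sigma : {rmorphism R -> R}} {delta : skew_der sigma}.
Local Notation A := (ore delta).
Local Notation ore_shift := (ore_shift delta).
Local Notation ore_mulp := (ore_mulp delta).
Implicit Types (a : R) (p q : {poly R}) (x y z : A).

HB.instance Definition _ := [isNew for @ore_poly R sigma delta].
HB.instance Definition _ := [Choice of A by <:].

Definition ore_zero : A := Ore delta 0.
Definition ore_opp x : A := Ore delta (- ore_poly x).
Definition ore_add x y : A := Ore delta (ore_poly x + ore_poly y).

Lemma ore_addA : associative ore_add.
Proof. by move=> x y z; rewrite /ore_add /= addrA. Qed.
Lemma ore_addC : commutative ore_add.
Proof. by move=> x y; rewrite /ore_add addrC. Qed.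
Lemma ore_add0 : left_id ore_zero ore_add.
Proof. by case=> p; rewrite /ore_add add0r. Qed.
Lemma ore_addN : left_inverse ore_zero ore_opp ore_add.
Proof. by case=> p; rewrite /ore_add addNr. Qed.

HB.instance Definition _ := GRing.isZmodule.Build A
  ore_addA ore_addC ore_add0 ore_addN.

Definition ore_mul x y : A := Ore delta (ore_mulp (ore_poly x) (ore_poly y)).

Lemma ore_shiftD : {morph ore_shift : p q / p + q}.
Proof.
move=> p q; rewrite /ore_shift rmorphD raddfD /= mulrDl.
by rewrite addrACA.
Qed.

Lemma ore_shift0 : ore_shift 0 = 0.
Proof. by rewrite /ore_shift !raddf0 mul0r addr0. Qed.

Lemma ore_shiftZ a p :
  ore_shift (a *: p) = sigma a *: ore_shift p + delta a *: p.
Proof.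
apply/polyP => i.
rewrite /ore_shift !(coefD, coefMX, coefZ, coef_map) /= skew_leibniz.
case: i => [|i] /=; first by rewrite !add0r addrC.
by rewrite rmorphM mulrDr -[RHS]addrA [in RHS](addrC (_ * delta _)).
Qed.

Lemma ore_iterD i : {morph iter i ore_shift : p q / p + q}.
Proof. by elim: i => // i IHi p q; rewrite /= IHi ore_shiftD. Qed.

Lemma ore_iter0 i : iter i ore_shift 0 = 0.
Proof. by elim: i => //= i ->; rewrite ore_shift0. Qed.

Lemma ore_mulp_wide n p q : (size p <= n)%N ->
  ore_mulp p q = \sum_(i < n) p`_i *: iter i ore_shift q.
Proof.
move=> le_pn; rewrite !ore_mulp.unlock.
rewrite (big_ord_widen n (fun i => p`_i *: iter i ore_shift q)) //.
rewrite big_mkcond; apply: eq_bigr => i _; case: ltnP => // le_pi.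
by rewrite nth_default // scale0r.
Qed.

Lemma ore_mulpDl p1 p2 q : ore_mulp (p1 + p2) q = ore_mulp p1 q + ore_mulp p2 q.
Proof.
pose n := maxn (size p1) (size p2).
rewrite (@ore_mulp_wide n p1) ?leq_maxl // (@ore_mulp_wide n p2) ?leq_maxr //.
rewrite (@ore_mulp_wide n) ?size_polyD // -big_split /=.
by apply: eq_bigr => i _; rewrite coefD scalerDl.
Qed.

Lemma ore_mulpDr p q1 q2 : ore_mulp p (q1 + q2) = ore_mulp p q1 + ore_mulp p q2.
Proof.
rewrite !ore_mulp.unlock -big_split /=; apply: eq_bigr => i _.
by rewrite ore_iterD scalerDr.
Qed.

Lemma ore_mulp0l q : ore_mulp 0 q = 0.
Proof. by rewrite !ore_mulp.unlock size_poly0 big_ord0. Qed.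

Lemma ore_mulpZl a p q : ore_mulp (a *: p) q = a *: ore_mulp p q.
Proof.
rewrite (@ore_mulp_wide (size p)) ?size_scale_leq // !ore_mulp.unlock.
rewrite scaler_sumr.
by apply: eq_bigr => i _; rewrite coefZ scalerA.
Qed.

Lemma ore_mulpXn n q : ore_mulp 'X^n q = iter n ore_shift q.
Proof.
rewrite !ore_mulp.unlock size_polyXn big_ord_recr /= coefXn eqxx scale1r.
rewrite big1 ?add0r //.
by move=> i _; rewrite coefXn ltn_eqF // scale0r.
Qed.

Lemma ore_mulpC a q : ore_mulp a%:P q = a *: q.
Proof. by rewrite (@ore_mulp_wide 1) ?size_polyC_leq1 // big_ord1 coefC. Qed.

Lemma ore_mulpX q : ore_mulp 'X q = ore_shift q.
Proof. exact: (ore_mulpXn 1 q). Qed.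

Lemma ore_poly_ind (P : {poly R} -> Prop) :
  P 0 -> (forall p q, P p -> P q -> P (p + q)) ->
  (forall a n, P (a *: 'X^n)) -> forall p, P p.
Proof.
move=> P0 PD PX p; rewrite -[p]coefK poly_def.
by elim/big_ind: _ => // i _.
Qed.

Lemma skew_der1 : delta 1 = 0.
Proof.
have := skew_leibniz delta 1 1; rewrite !mulr1 rmorph1 mul1r => /eqP.
by rewrite -subr_eq subrr eq_sym => /eqP.
Qed.

Lemma ore_shiftXn n : ore_shift 'X^n = 'X^(n.+1).
Proof.
rewrite /ore_shift map_polyXn -exprSr; apply/polyP => i.
rewrite coefD coef_map /= [in delta _]coefXn.
by case: eqP => _; rewrite ?skew_der1 ?raddf0 addr0.
Qed.

Lemma ore_mulp_shift p q : ore_mulp (ore_shift p) q = ore_shift (ore_mulp p q).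
Proof.
move: p; apply: ore_poly_ind => [|p1 p2 h1 h2|a n].
- by rewrite ore_shift0 ore_mulp0l ore_shift0.
- by rewrite ore_shiftD (ore_mulpDl (ore_shift p1)) h1 h2 ore_mulpDl ore_shiftD.
rewrite ore_shiftZ ore_shiftXn (ore_mulpDl (_ *: _)) !ore_mulpZl ore_shiftZ.
by rewrite !ore_mulpXn.
Qed.

Lemma ore_mulpA p q r : ore_mulp p (ore_mulp q r) = ore_mulp (ore_mulp p q) r.
Proof.
move: p; apply: ore_poly_ind => [|p1 p2 h1 h2|a n].
- by rewrite !ore_mulp0l.
- by rewrite !ore_mulpDl h1 h2.
rewrite !ore_mulpZl; congr (_ *: _); rewrite !ore_mulpXn.
by elim: n => //= n IHn; rewrite IHn ore_mulp_shift.
Qed.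

Definition oreC a : A := Ore delta a%:P.
Definition oreX : A := Ore delta 'X.

Lemma ore_mul1l : left_id (oreC 1) ore_mul.
Proof. by case=> p; rewrite /ore_mul /= ore_mulpC scale1r. Qed.

Lemma ore_mul1r : right_id (oreC 1) ore_mul.
Proof.
case=> p; congr Ore => /=; move: p; apply: ore_poly_ind => [|p q h1 h2|a n].
- by rewrite ore_mulp0l.
- by rewrite ore_mulpDl h1 h2.
rewrite ore_mulpZl ore_mulpXn; congr (_ *: _).
by elim: n => [|n IHn]; rewrite ?expr0 //= IHn ore_shiftXn.
Qed.

Lemma ore_mulA : associative ore_mul.
Proof. by move=> x y z; congr Ore; exact: ore_mulpA. Qed.

Lemma ore_mulDl : left_distributive ore_mul +%R.
Proof. by move=> x y z; congr Ore; exact: ore_mulpDl. Qed.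

Lemma ore_mulDr : right_distributive ore_mul +%R.
Proof. by move=> x y z; congr Ore; exact: ore_mulpDr. Qed.

Lemma ore_1neq0 : oreC 1 != 0.
Proof. by apply/eqP => -[] /eqP; rewrite oner_eq0. Qed.

HB.instance Definition _ := GRing.Zmodule_isNzRing.Build A
  ore_mulA ore_mul1l ore_mul1r ore_mulDl ore_mulDr ore_1neq0.

Lemma oreC_is_zmod_morphism : zmod_morphism oreC.
Proof. by move=> a b; congr Ore; rewrite polyCB. Qed.

Lemma oreC_is_monoid_morphism : monoid_morphism oreC.
Proof.
split=> // a b; congr Ore => /=.
by rewrite ore_mulpC -mul_polyC polyCM.
Qed.

HB.instance Definition _ := GRing.isZmodMorphism.Build R A oreC
  oreC_is_zmod_morphism.
HB.instance Definition _ := GRing.isMonoidMorphism.Build R A oreC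
  oreC_is_monoid_morphism.

Lemma ore_commX a : oreX * oreC a = oreC (sigma a) * oreX + oreC (delta a).
Proof.
congr Ore; rewrite /= ore_mulpX ore_mulpC -mul_polyC /ore_shift map_polyC.
by congr (_ + _); apply/polyP => i; rewrite coef_map /= !coefC; case: eqP;
  rewrite ?raddf0.
Qed.

Lemma ore_expX n : oreX ^+ n = Ore delta 'X^n.
Proof.
elim: n => [|n IHn]; first by rewrite !expr0.
rewrite exprS IHn; congr Ore => /=.
by rewrite ore_mulpX ore_shiftXn.
Qed.

Lemma ore_sumE n (a : nat -> R) :
  \sum_(i < n) oreC (a i) * oreX ^+ i = Ore delta (\poly_(i < n) a i).
Proof.
have fD : {morph Ore delta : p q / p + q} by [].
rewrite poly_def (big_morph _ fD (erefl : Ore delta 0 = 0)).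
apply: eq_bigr => i _; rewrite ore_expX; congr Ore => /=.
by rewrite ore_mulpC.
Qed.

Lemma ore_basis x :
  x = \sum_(i < size (ore_poly x)) oreC (ore_poly x)`_i * oreX ^+ i.
Proof. by rewrite (ore_sumE _ (nth 0 (ore_poly x))) coefK; case: x. Qed.

End OreExtension.

Record funit (k : fieldType) := FUnit {
  funit_val : k;
  funit_neq0 : funit_val != 0
}.

Section UnitGroup.
Context {k : fieldType}.
Implicit Types a b c : funit k.

HB.instance Definition _ := [isSub for @funit_val k].
HB.instance Definition _ := [Choice of funit k by <:].

Definition funit_one : funit k := FUnit (oner_neq0 k).
Definition funit_mul a b : funit k :=
  FUnit (mulf_neq0 (funit_neq0 a) (funit_neq0 b)).
Definition funit_inv a : funit k := FUnit (invr_neq0 (funit_neq0 a)).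

Lemma funit_mulA : associative funit_mul.
Proof. by move=> a b c; apply: val_inj; rewrite /= mulrA. Qed.
Lemma funit_mul1 : left_id funit_one funit_mul.
Proof. by move=> a; apply: val_inj; rewrite /= mul1r. Qed.
Lemma funit_mulr1 : right_id funit_one funit_mul.
Proof. by move=> a; apply: val_inj; rewrite /= mulr1. Qed.
Lemma funit_mulV : left_inverse funit_one funit_inv funit_mul.
Proof. by move=> a; apply: val_inj; rewrite /= mulVf // funit_neq0. Qed.
Lemma funit_mulrV : right_inverse funit_one funit_inv funit_mul.
Proof. by move=> a; apply: val_inj; rewrite /= mulfV // funit_neq0. Qed.

HB.instance Definition _ := isGroup.Build (funit k)
  funit_mulA funit_mul1 funit_mulr1 funit_mulV funit_mulrV.

End UnitGroup.

(* [Aff a b] is the affine map X |-> a X + b. *)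
Record aff (k : fieldType) := Aff { aff_lin : funit k; aff_tr : k }.

Section AffineGroup.
Context {k : fieldType}.
Implicit Types p q r : aff k.

Definition aff_to_pair p := (aff_lin p, aff_tr p).
Definition pair_to_aff (u : funit k * k) := Aff u.1 u.2.
Lemma aff_to_pairK : cancel aff_to_pair pair_to_aff.
Proof. by case. Qed.

HB.instance Definition _ := Choice.copy (aff k) (can_type aff_to_pairK).

Definition aff_one : aff k := Aff 1%g 0.
(* [aff_mul p q] is the composite X |-> p (q X). *)
Definition aff_mul p q : aff k :=
  Aff (aff_lin p * aff_lin q)%g
      (funit_val (aff_lin p) * aff_tr q + aff_tr p).
Definition aff_inv p : aff k :=
  Aff (aff_lin p)^-1%g (- (funit_val (aff_lin p)^-1%g * aff_tr p)).

Lemma aff_mulA : associative aff_mul.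
Proof.
move=> p q r; congr Aff; first by rewrite mulgA.
by rewrite /= mulrDr mulrA addrA.
Qed.
Lemma aff_mul1 : left_id aff_one aff_mul.
Proof. by case=> a b; rewrite /aff_mul /= mul1g mul1r addr0. Qed.
Lemma aff_mulr1 : right_id aff_one aff_mul.
Proof. by case=> a b; rewrite /aff_mul /= mulg1 mulr0 add0r. Qed.
Lemma aff_mulV : left_inverse aff_one aff_inv aff_mul.
Proof. by case=> a b; rewrite /aff_mul /= mulVg subrr. Qed.
Lemma aff_mulrV : right_inverse aff_one aff_inv aff_mul.
Proof.
case=> a b; rewrite /aff_mul /= mulgV mulrN mulrA mulfV ?funit_neq0 //.
by rewrite mul1r addNr.
Qed.

HB.instance Definition _ := isGroup.Build (aff k)
  aff_mulA aff_mul1 aff_mulr1 aff_mulV aff_mulrV.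

Definition aff_poly p : {poly k} :=
  funit_val (aff_lin p) *: 'X + (aff_tr p)%:P.

Definition aff_act (K : fieldType) (iota : {rmorphism k -> K}) p (x : K) : K :=
  iota (funit_val (aff_lin p)) * x + iota (aff_tr p).

Definition aff_orbit (K : fieldType) (iota : {rmorphism k -> K})
    (S : set (aff k)) (x : K) : set K :=
  [set aff_act iota p x | p in S].

End AffineGroup.

Section CrossedHoms.
Context {k : fieldType} {G : groupType} (chi : {multiplicative G -> funit k}).

Definition Z1_pred : {pred G -> k} :=
  [pred c : G -> k |
    `[< forall x y, c (x * y)%g = c x + funit_val (chi x) * c y >]].

Lemma Z1_closed : zmod_closed Z1_pred.
Proof.
split=> [|c d /asboolP cZ /asboolP dZ]; apply/asboolP => x y.
  by rewrite mulr0 addr0.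
rewrite ![(c - d) _]/(c _ - d _) cZ dZ mulrBr opprD.
by rewrite addrACA.
Qed.

HB.instance Definition _ := GRing.isZmodClosed.Build (G -> k) Z1_pred Z1_closed.

Record Z1 := MkZ1 { Z1_val :> G -> k; Z1_valP : Z1_val \in Z1_pred }.

HB.instance Definition _ := [isSub for Z1_val].
HB.instance Definition _ := [Choice of Z1 by <:].
HB.instance Definition _ := [SubChoice_isSubZmodule of Z1 by <:].

Lemma Z1P (c : Z1) x y : c (x * y)%g = c x + funit_val (chi x) * c y.
Proof. by have /asboolP -> := Z1_valP c. Qed.

Definition B1_pred : {pred Z1} :=
  [pred c : Z1 | `[< exists x, forall t, c t = x * (funit_val (chi t) - 1) >]].

Lemma B1_closed : zmod_closed B1_pred.
Proof.
split=> [|c d /asboolP[x cx] /asboolP[y dy]]; apply/asboolP.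
  by exists 0 => t; rewrite mul0r.
by exists (x - y) => t; rewrite mulrBl -cx -dy.
Qed.

HB.instance Definition _ := GRing.isZmodClosed.Build Z1 B1_pred B1_closed.

(* Only the additive group structure of Z^1 / B^1 is recorded. *)
Definition H1 := Quotient.quot B1_pred.
HB.instance Definition _ := GRing.Zmodule.on H1.

Definition H1_class (c : Z1) : H1 := (\pi_H1 c)%qT.

Lemma H1_class_eq0 (c : Z1) : H1_class c = 0 <-> c \in B1_pred.
Proof.
rewrite -[c in c \in _]subr0 Quotient.idealrBE /H1_class; split=> [|/eqP].
  by move=> pi_c0; rewrite [X in X == _]pi_c0 raddf0.
by rewrite raddf0.
Qed.

End CrossedHoms.

Record subgrp (G : groupType) (H : groupClosed G) :=
  MkSubgrp { subgrp_val : G; subgrp_valP : subgrp_val \in H }.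

Section Subgroups.
Context {G : groupType} (H : groupClosed G).

HB.instance Definition _ := [isSub for @subgrp_val G H].
HB.instance Definition _ := [Choice of subgrp H by <:].

Lemma subgrp_closed : group_closed H.
Proof. by split=> [|x y]; [exact: gpred1 | exact: gpredF]. Qed.

HB.instance Definition _ :=
  SubChoice_isSubGroup.Build G (mem H) (subgrp H) subgrp_closed.

Definition lcoset (x : G) : set G := [set (x * h)%g | h in [set` H]].

Definition finite_index : Prop := finite_set (range lcoset).

End Subgroups.

Section Restriction.
Context {k : fieldType} {G : groupType} {chi : {multiplicative G -> funit k}}.
Context (H : groupClosed G).

Definition res_char : {multiplicative subgrp H -> funit k} :=
  chi \o \val.

Lemma res_Z1_subproof (c : Z1 chi) : c \o \val \in Z1_pred res_char.
Proof. by apply/asboolP => x y; exact: Z1P. Qed.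

Definition res_Z1 (c : Z1 chi) : Z1 res_char := MkZ1 (res_Z1_subproof c).

End Restriction.

(* The last clause says that the classes of x and y commute in G / N. *)
Definition metabelian (G : groupType) : Prop :=
  exists N : groupClosed G,
    [/\ {in N &, forall x y, x * y = y * x}%g,
        forall x y : G, x \in N -> (x ^ y)%g \in N
      & forall x y : G, lcoset N (x * y)%g = lcoset N (y * x)%g].

Section Ideals.
Context {A : nzRingType}.
Implicit Types I S : set A.

Definition two_sided_ideal I : Prop :=
  [/\ I 0, forall x y, I x -> I y -> I (x - y)
    & forall a x, I x -> I (a * x) /\ I (x * a)].

Definition simple_ring : Prop :=
  forall I, two_sided_ideal I -> I = [set 0] \/ I = setT.

Definition lprincipal (x : A) : set A := range (fun a => a * x).

Definition homogeneous (G : Type) (gr : G -> set A) : set A :=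
  [set x | exists g, gr g x].

Definition graded_ideal (G : Type) (gr : G -> set A) I : Prop :=
  exists2 S, S `<=` homogeneous gr & I = smallest two_sided_ideal S.

Definition gr_simple (G : Type) (gr : G -> set A) : Prop :=
  forall I, graded_ideal gr I -> I = [set 0] \/ I = setT.

End Ideals.

Arguments simple_ring A : clear implicits.

Definition algebraic_closure (k : fieldType) (kbar : closedFieldType)
  (iota : {rmorphism k -> kbar}) : Prop := forall x, algebraicOver iota x.

Section OreOverGroupAlgebra.
Context {k : fieldType} {G : groupType}.
Variables (gamma : G) (chi : {multiplicative G -> funit k}).
Local Notation U := (@galg_elt k G).

Definition sigma : galg k G -> galg k G :=
  mlift (fun x => funit_val (chi x) *: U (gamma * x * gamma^-1)%g).

HB.instance Definition _ := GRing.Linear.on sigma.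

Lemma sigmaE x : sigma (U x) = funit_val (chi x) *: U (gamma * x * gamma^-1)%g.
Proof. by rewrite /sigma mliftU scale1r. Qed.

Lemma sigma_is_monoid_morphism : monoid_morphism sigma.
Proof.
have chiM x y :
  funit_val (chi (x * y)%g) = funit_val (chi x) * funit_val (chi y).
  by rewrite gmulfM.
have chi1 : funit_val (chi 1%g) = 1.
  apply: (mulfI (funit_neq0 (chi 1%g))).
  by rewrite -chiM mulg1 mulr1.
split=> [|u v].
  by rewrite -galg_elt1 sigmaE chi1 scale1r mulg1 mulgV.
move: u; apply: galg_ind => [|u1 u2 h1 h2|a x].
- by rewrite mul0r !raddf0 mul0r.
- by rewrite mulrDl (raddfD sigma) /= h1 h2 (raddfD sigma) /= mulrDl.
rewrite -scalerAl !linearZ /= -scalerAl; congr (_ *: _).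
move: v; apply: galg_ind => [|u1 u2 h1 h2|b y].
- by rewrite mulr0 !raddf0 mulr0.
- by rewrite mulrDr (raddfD sigma) /= h1 h2 (raddfD sigma) /= mulrDr.
rewrite -scalerAr !linearZ /= -scalerAr; congr (_ *: _).
rewrite galg_eltM !sigmaE -scalerAl -scalerAr scalerA chiM galg_eltM.
by congr (_ *: U _); rewrite !mulgA mulgVK.
Qed.

HB.instance Definition _ := GRing.isMonoidMorphism.Build (galg k G) (galg k G)
  sigma sigma_is_monoid_morphism.

Variable c : Z1 chi.

Definition delta_fun : galg k G -> galg k G :=
  mlift (fun x => c x *: U (gamma * x)%g).

HB.instance Definition _ := GRing.Linear.on delta_fun.

Lemma delta_funE x : delta_fun (U x) = c x *: U (gamma * x)%g.
Proof. by rewrite /delta_fun mliftU scale1r. Qed.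

Lemma delta_leibniz u v :
  delta_fun (u * v) = delta_fun u * v + sigma u * delta_fun v.
Proof.
have dD : {morph delta_fun : x y / x + y} by exact: linearD.
have dZ a : {morph delta_fun : x / a *: x} by exact: linearZ.
have d0 : delta_fun 0 = 0 by exact: linear0.
have sD : {morph sigma : x y / x + y} by exact: linearD.
have sZ a : {morph sigma : x / a *: x} by exact: linearZ.
have s0 : sigma 0 = 0 by exact: linear0.
have dU := delta_funE; have sU := sigmaE.
move: (delta_fun) (sigma) dD dZ d0 dU sD sZ s0 sU.
move=> d s dD dZ d0 dU sD sZ s0 sU.
move: u; apply: galg_ind => [|u1 u2 h1 h2|a x].
- by rewrite mul0r d0 s0 !mul0r addr0.
- by rewrite mulrDl !dD h1 h2 sD !mulrDl addrACA.
rewrite -scalerAl !dZ sZ -!scalerAl -scalerDr; congr (_ *: _).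
move: v; apply: galg_ind => [|v1 v2 h1 h2|b y].
- by rewrite mulr0 d0 !mulr0 addr0.
- by rewrite mulrDr !dD h1 h2 !mulrDr addrACA.
rewrite -scalerAr !dZ -!scalerAr -scalerDr; congr (_ *: _).
rewrite galg_eltM !dU sU -!scalerAl -scalerAr !galg_eltM Z1P.
by rewrite scalerDl scalerA !mulgA mulgVK.
Qed.

Definition delta : skew_der sigma := @SkewDer _ sigma delta_fun delta_leibniz.

Definition Agrading (alpha : G) : set (ore delta) :=
  [set p | forall n, exists a, (ore_poly p)`_n = a *: U (alpha * gamma ^- n)%g].

Lemma Agrading_oreX : Agrading gamma oreX.
Proof.
case=> [|[|n]]; [exists 0 | exists 1 | exists 0]; rewrite coefX /=.
- by rewrite scale0r.
- by rewrite scale1r expg1 mulgV galg_elt1.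
- by rewrite scale0r.
Qed.

(* s = gamma^-1 t and, below, f(s) for f in k[X]. *)
Definition sA : ore delta := oreC (U gamma^-1%g) * oreX.

Definition evalA (f : {poly k}) : ore delta :=
  (map_poly (fun a => oreC a%:A) f).[sA].

Definition Phi (x : G) : aff k := Aff (chi x) (c x).

Lemma Phi_is_multiplicative : {morph Phi : x y / (x * y)%g}.
Proof.
move=> x y; congr Aff; first exact: gmulfM.
by rewrite Z1P addrC.
Qed.

HB.instance Definition _ := monoid.isMultiplicative.Build G (aff k) Phi
  Phi_is_multiplicative.

Definition semi_invariant (f : {poly k}) : Prop :=
  forall x : G, exists2 a, a != 0 & f \Po aff_poly (Phi x) = a *: f.

End OreOverGroupAlgebra.

Arguments Agrading {k G} gamma {chi} c alpha _.

Lemma sigma_bij (k : fieldType) (G : groupType) (gamma : G)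
  (chi : {multiplicative G -> funit k}) : bijective (sigma gamma chi).
Proof.
pose tau : galg k G -> galg k G :=
  mlift (fun x =>
    (funit_val (chi x))^-1 *: galg_elt k (gamma^-1 * x * gamma)%g).
have tauD : {morph tau : u v / u + v} by exact: linearD.
have tauZ a : {morph tau : u / a *: u} by exact: linearZ.
have tau0 : tau 0 = 0 by exact: linear0.
have tauU x : tau (galg_elt k x) =
    (funit_val (chi x))^-1 *: galg_elt k (gamma^-1 * x * gamma)%g.
  by rewrite /tau mliftU scale1r.
have chiJ x y :
  funit_val (chi (x * y)%g) = funit_val (chi x) * funit_val (chi y).
  by rewrite gmulfM.
have chi1 : funit_val (chi 1%g) = 1.
  by apply: (mulfI (funit_neq0 (chi 1%g))); rewrite -chiJ mulg1 mulr1.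
have chiC x : funit_val (chi (gamma * x * gamma^-1)%g) = funit_val (chi x).
  by rewrite !chiJ mulrAC -chiJ mulgV chi1 mul1r.
have chiC' x : funit_val (chi (gamma^-1 * x * gamma)%g) = funit_val (chi x).
  by rewrite !chiJ mulrAC -chiJ mulVg chi1 mul1r.
exists tau; apply: galg_ind => [|u v hu hv|a x].
- by rewrite linear0 tau0.
- by rewrite linearD tauD /= hu hv.
- rewrite linearZ /= sigmaE !tauZ tauU chiC; congr (_ *: _).
  rewrite scalerA mulfV ?funit_neq0 // scale1r.
  by rewrite !mulgA mulVg mul1g mulgVK.
- by rewrite tau0 linear0.
- by rewrite tauD linearD /= hu hv.
rewrite tauZ tauU !linearZ /= sigmaE chiC'; congr (_ *: _).
rewrite scalerA mulVf ?funit_neq0 // scale1r.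
by rewrite !mulgA mulgV mul1g mulgK.
Qed.

(* Main.v *)
From HB Require Import structures.
Require Import Defs.
From mathcomp Require Import all_boot all_order all_algebra.
From mathcomp Require Import finmap monalg.
From mathcomp Require Import boolp classical_sets functions cardinality.

Set Implicit Arguments.
Unset Strict Implicit.
Unset Printing Implicit Defensive.

Import GRing.Theory.

Local Open Scope classical_set_scope.
Local Open Scope ring_scope.

(** Why the theorem holds.

    With s = gamma^-1 t the defining relation of A becomes
    s tau = tau (chi(tau) s + c(tau)), that is f(s) tau = tau f(phi_tau(s)).
    Since t = gamma s, each t^n is gamma^n times a polynomial in s, and A is a
    skew group ring: a free right k[s]-module on the elements of G, whose
    component of degree tau is tau k[s] ([combine_surj], [combine_inj],
    [Agrading_mon], [mon_Agrading]). Everything else is deduced from this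
    description alone, in an arbitrary ring B that satisfies it; the Ore
    multiplication does not come back.

    (1) The trace on k[s] of a two-sided ideal is an ideal of k[X] stable
    under f |-> f o phi_tau. Its monic generator f divides f o phi_tau, which
    has the same degree, so f is semi-invariant ([ideal_ev_principal]). A
    graded ideal is recovered from its trace because homogeneous elements are
    units tau times elements of k[s] ([graded_idealP]), and conversely the
    semi-invariance of f is what makes the left ideal A f(s) two-sided.

    (2) Hence A is gr-simple exactly when 1 is the only monic semi-invariant
    polynomial ([gr_simpleP]). The roots of a semi-invariant f are permuted by
    Phi(G), so they have finite orbits; conversely the polynomials over k that
    vanish on a finite orbit form a nonzero proper stable ideal
    ([no_finite_orbitP]). A finite orbit is a point fixed by a subgroup of
    finite index, and a fixed point x of H means c = x (1 - chi) on H. This x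
    lies in k as soon as chi is nontrivial on H, and otherwise c vanishes on H:
    so a fixed point is the same as the vanishing of the class
    ([fixed_point_H1], [H1_fixed_point]).

    (3) In characteristic 0 the mean of a finite orbit is a fixed point of the
    whole of G ([char0_fixed_point]).

    (4) A acts on the right on k[X], s by multiplication by X and tau by
    p |-> p o phi_tau. The kernel of this action is a proper ideal containing
    tau - rho whenever phi_tau = phi_rho, so simplicity forces Phi to be
    injective ([simple_Phi_inj]). Conversely let Phi be injective and let x be
    a nonzero element of an ideal I with tau in its support. Passing from x to
    (tau s tau^-1) x - x s removes precisely tau from the support; iterating,
    I contains some tau f(s) with f nonzero ([ideal_meets_ev]), and
    gr-simplicity gives 1 in I. Finally Aff(1,k) is metabelian, its
    translations being the kernel of the linear part ([Phi_inj_metabelian]). *)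

(** * Substitution of affine polynomials *)

Section AffineSubstitution.
Context {k : fieldType}.
Implicit Types p q : aff k.

Lemma size_aff_poly p : size (aff_poly p) = 2.
Proof.
rewrite /aff_poly -mul_polyC size_MXaddC polyC_eq0 (negPf (funit_neq0 _)) /=.
by rewrite size_polyC funit_neq0.
Qed.

Lemma aff_polyM p q : aff_poly (p * q)%g = aff_poly p \Po aff_poly q.
Proof.
rewrite /aff_poly comp_polyD comp_polyZ comp_polyX comp_polyC /=.
rewrite scalerDr scalerA -addrA; congr (_ + _).
by rewrite polyCD polyCM mul_polyC.
Qed.

Lemma aff_poly1 : aff_poly (1%g : aff k) = 'X.
Proof. by rewrite /aff_poly scale1r polyC0 addr0. Qed.

Lemma aff_poly_inj : injective (@aff_poly k).
Proof.
move=> [[a a0] b] [[a' a0'] b'] /polyP eq_ab.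
have := eq_ab 0; have := eq_ab 1.
rewrite /aff_poly /= !(coefD, coefZ, coefX, coefC) /=.
rewrite !mulr1 !mulr0 !addr0 !add0r.
by move=> eqa eqb; congr Aff => //; apply: val_inj.
Qed.

Lemma comp_aff_poly1 (f : {poly k}) : f \Po aff_poly 1%g = f.
Proof. by rewrite aff_poly1 comp_polyXr. Qed.

End AffineSubstitution.

Section CharacterAtOne.
Context {k : fieldType} {G : groupType} {chi : {multiplicative G -> funit k}}.
Implicit Type c : Z1 chi.

Lemma char_at1 : chi 1%g = 1%g.
Proof. by apply: (mulgI (chi 1%g)); rewrite -gmulfM !mulg1. Qed.

Lemma Z1_at1 c : c 1%g = 0.
Proof.
have := Z1P c 1%g 1%g; rewrite mulg1 char_at1 mul1r => /eqP.
by rewrite -subr_eq subrr eq_sym => /eqP.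
Qed.

Lemma Phi1 c : Phi c 1%g = 1%g.
Proof. by rewrite /Phi char_at1 Z1_at1. Qed.

End CharacterAtOne.

(** * Skew group rings over k[X] *)

Section RightModule.
Context {P : comNzRingType} {B : nzRingType}.

(** A renaming of B on which the commutative ring P acts by right
    multiplication through ev; commutativity of P makes this a left module
    structure, so that linear extension of maps applies. *)
Definition rmod (ev : {rmorphism P -> B}) : Type := B.

Context (ev : {rmorphism P -> B}).

HB.instance Definition _ := GRing.Zmodule.on (rmod ev).

Definition rmod_scale (f : P) (x : rmod ev) : rmod ev := (x : B) * ev f.

Lemma rmod_scaleA f g x :
  rmod_scale f (rmod_scale g x) = rmod_scale (f * g) x.
Proof. by rewrite /rmod_scale -mulrA -rmorphM mulrC. Qed.
Lemma rmod_scale1 : left_id 1 rmod_scale.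
Proof. by move=> x; rewrite /rmod_scale rmorph1 mulr1. Qed.
Lemma rmod_scaleDr : right_distributive rmod_scale +%R.
Proof. by move=> f x y; rewrite /rmod_scale mulrDl. Qed.
Lemma rmod_scaleDl x : {morph rmod_scale^~ x : f g / f + g}.
Proof. by move=> f g; rewrite /rmod_scale rmorphD mulrDr. Qed.

HB.instance Definition _ := GRing.Zmodule_isLmodule.Build P (rmod ev)
  rmod_scaleA rmod_scale1 rmod_scaleDr rmod_scaleDl.

End RightModule.

Section SkewRelations.
Context {k : fieldType} {G : groupType}.
Context {chi : {multiplicative G -> funit k}} (c : Z1 chi).
Context {B : nzRingType} (e : G -> B) (ev : {rmorphism {poly k} -> B}).
Implicit Types (x y : B) (f g : {poly k}) (u v w : G).

(** The relations e(u) and ev(f) satisfy in a skew group ring, checked on the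
    generators of k[X] only; [skew_e] extends them to all polynomials. *)
Record skew_relations : Prop := SkewRelations {
  skew_e1 : e 1%g = 1;
  skew_eM : forall u v, e u * e v = e (u * v)%g;
  skew_eC : forall a u, ev a%:P * e u = e u * ev a%:P;
  skew_eX : forall u, ev 'X * e u = e u * ev (aff_poly (Phi c u))
}.

Definition mon u f : B := e u * ev f.

(** The right k[X]-linear map sending the basis vector u to e u. A ring with
    [skew_relations] is the skew group ring of G over k[X] when this map is
    bijective. *)
Definition combine : {malg {poly k}[G]} -> rmod ev :=
  mlift (e : G -> rmod ev).

HB.instance Definition _ := GRing.Linear.on combine.

Lemma combineU f u : combine << f *g u >> = mon u f.
Proof. by rewrite /combine mliftU. Qed.

Lemma combine0 : combine 0 = 0.
Proof. exact: linear0. Qed.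

Lemma combineD : {morph combine : g h / g + h}.
Proof. exact: linearD. Qed.

Lemma combineB : {morph combine : g h / g - h}.
Proof. exact: linearB. Qed.

Lemma monD u f g : mon u (f + g) = mon u f + mon u g.
Proof. by rewrite /mon rmorphD mulrDr. Qed.

Lemma mon0 u : mon u 0 = 0.
Proof. by rewrite /mon rmorph0 mulr0. Qed.

Context (R : skew_relations).

Lemma skew_e f u : ev f * e u = e u * ev (f \Po aff_poly (Phi c u)).
Proof.
elim/poly_ind: f => [|f a IHf].
  by rewrite comp_poly0 !rmorph0 mul0r mulr0.
rewrite comp_poly_MXaddC !rmorphD !rmorphM /= mulrDl mulrDr (skew_eC R).
by rewrite -mulrA (skew_eX R) mulrA IHf mulrA.
Qed.

Lemma monM u f v g :
  mon u f * mon v g = mon (u * v)%g ((f \Po aff_poly (Phi c v)) * g).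
Proof.
rewrite /mon -mulrA (mulrA (ev f)) skew_e rmorphM -(skew_eM R).
by rewrite !mulrA.
Qed.

Lemma monE u : mon u 1 = e u.
Proof. by rewrite /mon rmorph1 mulr1. Qed.

Lemma mon1 f : mon 1%g f = ev f.
Proof. by rewrite /mon (skew_e1 R) mul1r. Qed.

(** The homogeneous pieces e(u) k[X] multiply like the group, so a power of one
    of their elements stays in the piece of the power. *)
Lemma mon_exp u f n : exists g, mon u f ^+ n = mon (u ^+ n)%g g.
Proof.
elim: n => [|n [g gE]]; first by exists 1; rewrite monE expg0 (skew_e1 R).
by rewrite exprS gE monM -expgS; eexists.
Qed.

End SkewRelations.

(** * The Ore extension as a skew group ring *)

Lemma coef_ore_shift (R : nzRingType) (sigma : {rmorphism R -> R})
    (delta : skew_der sigma) (p : {poly R}) n :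
  (ore_shift delta p)`_n =
  (if n is n'.+1 then sigma p`_n' else 0) + delta p`_n.
Proof. by rewrite /ore_shift coefD coefMX !coef_map /=; case: n. Qed.

Lemma size_ore_shift (R : nzRingType) (sigma : {rmorphism R -> R})
    (delta : skew_der sigma) (p : {poly R}) :
  injective sigma -> p != 0 -> size (ore_shift delta p) = (size p).+1.
Proof.
move=> sigma_inj p0.
have sz : size (map_poly sigma p) = size p.
  by rewrite size_map_inj_poly ?rmorph0.
have nz : map_poly sigma p != 0 by rewrite -size_poly_eq0 sz size_poly_eq0.
rewrite /ore_shift size_polyDl size_mulX // sz // ltnS; exact: size_poly.
Qed.

(** How t e(u) becomes s e(u) for s = e(v^-1) t: left multiplication by
    e(v^-1) turns the twist by v in both terms of the Ore relation into e(u),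
    which only needs the scalar a = chi(u) to commute
    with e(v^-1). *)
Lemma skew_commutation (B : nzRingType) (G : groupType) (e : G -> B)
    (a b t : B) (v u : G) :
  (forall x y, e x * e y = e (x * y)%g) -> GRing.comm a (e v^-1%g) ->
  t * e u = e (v * u * v^-1)%g * a * t + e (v * u)%g * b ->
  e v^-1%g * t * e u = e u * (a * (e v^-1%g * t) + b).
Proof.
move=> eM ca tu; rewrite -mulrA tu !mulrDr; congr (_ + _); last first.
  by rewrite mulrA eM mulKg.
by rewrite (mulrA a) ca !mulrA !eM !mulgA mulVg mul1g.
Qed.

Section OreIsSkew.
Context {k : fieldType} {G : groupType} (gamma : G).
Context {chi : {multiplicative G -> funit k}} (c : Z1 chi).
Local Notation A := (ore (delta gamma c)).
Local Notation U := (@galg_elt k G).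
Local Notation s := (sA gamma c).
Local Notation ev := (evalA gamma c).
Implicit Types (x y : A) (f g : {poly k}) (u v w : G).

Definition gelt u : A := oreC (U u).

Lemma geltM u v : gelt u * gelt v = gelt (u * v)%g.
Proof. by rewrite /gelt -rmorphM /= galg_eltM. Qed.

(** The scalars of k in A; bundled as a ring morphism because [evalA] is the
    polynomial evaluation along it, which is multiplicative once s commutes
    with its values ([scal_comm]). *)
Definition scal (a : k) : A := oreC a%:A.

Lemma scal_is_zmod_morphism : zmod_morphism scal.
Proof. by move=> a b; rewrite /scal scalerBl rmorphB. Qed.
Lemma scal_is_monoid_morphism : monoid_morphism scal.
Proof.
split=> [|a b]; first by rewrite /scal scale1r rmorph1.
by rewrite /scal -rmorphM /= -scalerAl mul1r scalerA.
Qed.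
HB.instance Definition _ :=
  GRing.isZmodMorphism.Build k A scal scal_is_zmod_morphism.
HB.instance Definition _ :=
  GRing.isMonoidMorphism.Build k A scal scal_is_monoid_morphism.

Lemma scalE (a : k) (z : galg k G) : scal a * oreC z = oreC (a *: z).
Proof. by rewrite /scal -rmorphM /= -scalerAl mul1r. Qed.

Lemma scal_gelt a u : scal a * gelt u = gelt u * scal a.
Proof. by rewrite /scal /gelt -!rmorphM /= -scalerAl -scalerAr mul1r mulr1. Qed.

Lemma oreX_oreC (z : galg k G) : (oreX : A) * oreC z =
  oreC (sigma gamma chi z) * oreX + oreC (delta_fun gamma c z).
Proof. exact (ore_commX z). Qed.

Lemma oreX_gelt u : (oreX : A) * gelt u =
  gelt (gamma * u * gamma^-1)%g * scal (funit_val (chi u)) * oreX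
  + gelt (gamma * u)%g * scal (c u).
Proof.
rewrite oreX_oreC (sigmaE gamma chi u) delta_funE.
by congr (_ * _ + _); rewrite -scal_gelt; apply/esym; exact: scalE.
Qed.

Lemma oreX_scal a : (oreX : A) * scal a = scal a * oreX.
Proof.
have sZ : sigma gamma chi (a *: 1) = a *: sigma gamma chi 1 by exact: linearZ.
have dZ : delta_fun gamma c (a *: 1) = a *: delta_fun gamma c 1.
  by exact: linearZ.
rewrite /scal oreX_oreC sZ dZ -galg_elt1 (sigmaE gamma chi) delta_funE.
by rewrite char_at1 Z1_at1 scale0r scaler0 rmorph0 addr0 mulg1 mulgV scale1r.
Qed.

Lemma scal_comm : commr_rmorph scal s.
Proof.
move=> a; rewrite /GRing.comm /sA -[oreC _]/(gelt _).
by rewrite -[LHS]mulrA oreX_scal [LHS]mulrA -scal_gelt -[LHS]mulrA.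
Qed.

Lemma evalA_is_zmod_morphism : zmod_morphism ev.
Proof. exact: (rmorphB (horner_morph scal_comm)). Qed.
Lemma evalA_is_monoid_morphism : monoid_morphism ev.
Proof.
split; first exact: (rmorph1 (horner_morph scal_comm)).
exact: (rmorphM (horner_morph scal_comm)).
Qed.
HB.instance Definition _ :=
  GRing.isZmodMorphism.Build {poly k} A ev evalA_is_zmod_morphism.
HB.instance Definition _ :=
  GRing.isMonoidMorphism.Build {poly k} A ev evalA_is_monoid_morphism.

Lemma evalAC a : ev a%:P = scal a.
Proof. exact: (horner_morphC scal_comm). Qed.

Lemma evalAX : ev 'X = s.
Proof. exact: (horner_morphX scal_comm). Qed.

Lemma evalA_MXaddC f a : ev (f * 'X + a%:P) = s * ev f + scal a.
Proof. by rewrite mulrC rmorphD rmorphM /= evalAC evalAX. Qed.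

(** The relation s tau = tau (chi(tau) s + c(tau)). *)
Lemma evalA_skew : skew_relations c gelt ev.
Proof.
split=> [|u v|a u|u].
- by rewrite /gelt galg_elt1 rmorph1.
- exact: geltM.
- by rewrite /= evalAC scal_gelt.
rewrite /aff_poly -mul_polyC rmorphD rmorphM /= !evalAC evalAX.
apply: (skew_commutation (e := gelt)); first exact: geltM.
  exact: scal_gelt.
exact: oreX_gelt.
Qed.

Lemma oreX_mon : (oreX : A) = mon gelt ev gamma 'X.
Proof.
rewrite /mon /= evalAX /sA -[oreC _]/(gelt _) mulrA geltM mulgV.
by rewrite (skew_e1 evalA_skew) mul1r.
Qed.

(** Since t = gamma s lies in gamma k[s], t^n lies in gamma^n k[s]: this is what
    lets s replace t as a variable. *)
Lemma oreX_exp_mon n : exists f, (oreX : A) ^+ n = mon gelt ev (gamma ^+ n)%g f.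
Proof. by rewrite oreX_mon; exact: (mon_exp evalA_skew). Qed.

Lemma monZ a u f : mon gelt ev u (a *: f) = scal a * mon gelt ev u f.
Proof. by rewrite /mon -mul_polyC rmorphM /= evalAC mulrA -scal_gelt mulrA. Qed.

Lemma Agrading_mon u x : Agrading gamma c u x -> exists f, x = mon gelt ev u f.
Proof.
move=> gx; rewrite (ore_basis x).
elim/big_ind: _ => [|_ _ [f ->] [g ->]|i _]; first by exists 0; rewrite mon0.
  by exists (f + g); rewrite monD.
have [a ->] := gx i; have [f ->] := oreX_exp_mon i.
exists (a *: f); rewrite -(scalE a) -[oreC _]/(gelt _) monZ.
rewrite -[LHS]mulrA; congr (_ * _).
by rewrite /mon [LHS]mulrA geltM mulgVK.
Qed.

Lemma combine_surj x : exists z, combine gelt ev z = x.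
Proof.
rewrite (ore_basis x); elim/big_ind: _ => [|_ _ [f <-] [g <-]|i _].
- by exists 0; exact: combine0.
- by exists (f + g); exact: combineD.
move: (_`_i); apply: galg_ind => [|z t [f fE] [g gE]|a u].
- by exists 0; rewrite rmorph0 mul0r; exact: combine0.
- by exists (f + g); rewrite rmorphD /= mulrDl -fE -gE; exact: combineD.
have [f ->] := oreX_exp_mon i.
exists << a *: f *g u * gamma ^+ i >>%g; rewrite combineU monZ.
rewrite -(scalE a) -[oreC _]/(gelt _) -[RHS]mulrA; congr (_ * _).
by rewrite /mon [RHS]mulrA geltM.
Qed.

Lemma ore_poly_oreC_mul z x : ore_poly (oreC z * x) = z *: ore_poly x.
Proof. exact: ore_mulpC. Qed.

Lemma ore_poly_oreX_mul x :
  ore_poly (oreX * x) = ore_shift (delta gamma c) (ore_poly x).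
Proof. exact: ore_mulpX. Qed.

Lemma AgradingD u x y :
  Agrading gamma c u x -> Agrading gamma c u y -> Agrading gamma c u (x + y).
Proof.
move=> gx gy n; have [a xn] := gx n; have [b yn] := gy n.
by exists (a + b); rewrite coefD xn yn scalerDl.
Qed.

Lemma Agrading0 u : Agrading gamma c u 0.
Proof. by move=> n; exists 0; rewrite coef0 scale0r. Qed.

Lemma Agrading_gelt u v x :
  Agrading gamma c u x -> Agrading gamma c (v * u)%g (gelt v * x).
Proof.
move=> gx n; have [a xn] := gx n; exists a.
by rewrite ore_poly_oreC_mul coefZ xn -scalerAr galg_eltM mulgA.
Qed.

Lemma Agrading_scal a u x :
  Agrading gamma c u x -> Agrading gamma c u (scal a * x).
Proof.
move=> gx n; have [b xn] := gx n; exists (a * b).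
by rewrite ore_poly_oreC_mul coefZ xn -scalerAl mul1r scalerA.
Qed.

Lemma Agrading_mulX u x :
  Agrading gamma c u x -> Agrading gamma c (gamma * u)%g (oreX * x).
Proof.
have sZ a z : sigma gamma chi (a *: z) = a *: sigma gamma chi z.
  by exact: linearZ.
have dZ a z : delta_fun gamma c (a *: z) = a *: delta_fun gamma c z.
  by exact: linearZ.
move=> gx n; have [a xn] := gx n.
rewrite ore_poly_oreX_mul coef_ore_shift xn.
rewrite [X in _ + X]dZ delta_funE mulgA.
case: n xn => [|n] _ /=.
  by exists (a * c (u * gamma ^- 0)%g); rewrite add0r scalerA.
have [b ->] := gx n; rewrite sZ (sigmaE gamma chi).
set v := (gamma * _ * _)%g; have -> : v = (gamma * u * gamma ^- n.+1)%g.
  by rewrite /v expgS invgM !mulgA.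
by rewrite !scalerA -scalerDl; eexists.
Qed.

(** The degree of s is gamma^-1 gamma = 1. *)
Lemma Agrading_evalA f : Agrading gamma c 1%g (ev f).
Proof.
elim/poly_ind: f => [|f a IHf]; first by rewrite rmorph0; exact: Agrading0.
rewrite evalA_MXaddC; apply: AgradingD.
  rewrite /sA -[_ * ev f]mulrA -[1%g](mulVg gamma).
  rewrite -[gamma in (_ * gamma)%g]mulg1.
  by apply/Agrading_gelt/Agrading_mulX.
rewrite -[scal a]mulr1; apply: Agrading_scal => -[|n].
  by exists 1; rewrite coefC /= scale1r mulgV galg_elt1.
by exists 0; rewrite coefC /= scale0r.
Qed.

Lemma mon_Agrading u f : Agrading gamma c u (mon gelt ev u f).
Proof.
rewrite -[u in Agrading _ _ u]mulg1; exact/Agrading_gelt/Agrading_evalA.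
Qed.

Lemma galg_elt_lreg v : GRing.lreg (U v).
Proof.
move=> z t /(congr1 (fun z => U v^-1%g * z)).
by rewrite !mulrA galg_eltM mulVg !mul1r.
Qed.

(** Sizes of left coefficient sequences measure the degree in t; the leading
    coefficient survives because sigma is injective and group elements are
    not zero divisors. *)
Lemma size_sA_mul x :
  x != 0 -> size (ore_poly (s * x)) = (size (ore_poly x)).+1.
Proof.
move=> x0.
rewrite /sA -[_ * x]mulrA ore_poly_oreC_mul lreg_size; last first.
  exact: galg_elt_lreg.
rewrite ore_poly_oreX_mul; apply: size_ore_shift.
  exact: (bij_inj (sigma_bij gamma chi)).
by apply: contra x0 => /eqP px; apply/eqP; apply: val_inj.
Qed.

Lemma size_evalA f : size (ore_poly (ev f)) = size f.
Proof.
elim/poly_ind: f => [|f a IHf]; first by rewrite rmorph0 !size_poly0.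
rewrite evalA_MXaddC size_MXaddC.
have [->|f0] := eqVneq f 0.
  rewrite rmorph0 mulr0 add0r size_polyC size_poly0 /=.
  have [->|a0] := eqVneq a 0; first by rewrite scale0r eqxx.
  case: eqP => // /malgP/(_ 1%g); rewrite mcoeffZ mcoeff0 mcoeffUU mulr1.
  by move/eqP; rewrite (negPf a0).
have e0 : ev f != 0.
  by apply: contra f0 => /eqP e0; rewrite -size_poly_eq0 -IHf e0 size_poly0.
rewrite size_polyDl size_sA_mul // IHf //.
rewrite (leq_ltn_trans (size_polyC_leq1 _)) // ltnS size_poly_gt0 //.
Qed.

Lemma evalA_inj f : ev f = 0 -> f = 0.
Proof.
move/(congr1 (fun x => size (ore_poly x)))/eqP.
by rewrite size_evalA size_poly0 size_poly_eq0 => /eqP.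
Qed.

(** Terms tau f(s) with distinct tau lie in distinct homogeneous components,
    whose coefficients of t^n sit at distinct group elements tau gamma^-n; so
    a vanishing sum has vanishing terms. *)
Lemma combine_inj : injective (combine gelt ev).
Proof.
suff K (g : {malg {poly k}[G]}) : combine gelt ev g = 0 -> g = 0.
  move=> g h gh; apply/eqP; rewrite -subr_eq0.
  by apply/eqP/K; rewrite combineB gh subrr.
move=> g0; apply/malgP => u; rewrite mcoeff0.
have [|/mcoeff_outdom//] := boolP (u \in msupp g) => ug.
apply: evalA_inj.
suff m0 : mon gelt ev u g@_u = 0.
  move: m0 => /(congr1 (fun x => gelt u^-1%g * x)).
  by rewrite /mon mulrA geltM mulVg mulr0 (skew_e1 evalA_skew) mul1r.
apply: val_inj; apply/polyP => n; rewrite coef0.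
have [a /= an] := mon_Agrading u g@_u n; rewrite an.
suff -> : a = 0 by rewrite scale0r.
(* The coefficient that sees, among all the e v, only e u. *)
pose co (x : A) : k := mcoeff (u * gamma ^- n)%g (ore_poly x)`_n.
have co0 : co 0 = 0 by rewrite /co coef0 mcoeff0.
have coD x y : co (x + y) = co x + co y by rewrite /co coefD mcoeffD.
have: co (combine gelt ev g) = 0 by rewrite g0.
rewrite /combine /mlift (big_morph co coD co0).
rewrite (big_fsetD1 u) //= big1_seq ?addr0 => [|v].
  rewrite /co [ore_poly _]/(ore_poly (mon gelt ev u g@_u)) an.
  by rewrite mcoeffZ mcoeffUU mulr1.
rewrite andTb !inE => /andP[vu _].
rewrite /co -[_ *: _]/(mon gelt ev v g@_v).
have [b ->] := mon_Agrading v g@_v n.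
by rewrite mcoeffZ mcoeffU (inj_eq (mulIg _)) (negPf vu) mulr0.
Qed.

End OreIsSkew.

(** * Invariant ideals of k[X] *)

Lemma poly_ideal_principal (k : fieldType) (J : set {poly k}) :
    J 0 -> (forall f g, J f -> J g -> J (f - g)) ->
    (forall g f, J f -> J (g * f)) ->
  exists f, (f = 0 \/ f \is monic) /\ forall g, J g <-> f %| g.
Proof.
move=> J0 JB JM.
have [[h [h0 Jh]]|noJ] := pselect (exists h, h != 0 /\ J h); last first.
  exists 0; split=> [|g]; first by left.
  rewrite dvd0p; split=> [Jg|/eqP->//].
  by apply/eqP; apply: contrapT => /eqP g0; apply: noJ; exists g.
pose P n := `[< exists h, [/\ h != 0, J h & size h = n] >].
have exP : exists n, P n by exists (size h); apply/asboolP; exists h.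
case: (ex_minnP exP) => n /asboolP[f [f0 Jf szf]] min_n.
have lf0 : (lead_coef f)^-1 != 0 by rewrite invr_eq0 lead_coef_eq0.
exists ((lead_coef f)^-1 *: f); split.
  by right; rewrite monicE lead_coefZ mulVf // lead_coef_eq0.
move=> g; rewrite dvdpZl //; split=> [Jg|/dvdpP[q ->]]; last exact: JM.
apply: contrapT => /negP; rewrite /dvdp => r0.
have Jr : J (g %% f).
  have -> : g %% f = g - (g %/ f) * f by rewrite {2}(divp_eq g f) addrC addKr.
  by apply: JB => //; exact: JM.
have /min_n : P (size (g %% f)) by apply/asboolP; exists (g %% f).
by rewrite -szf leqNgt ltn_modp f0.
Qed.

Lemma monic_dvdp_antisym (k : fieldType) (f g : {poly k}) :
  f \is monic -> g \is monic -> f %| g -> g %| f -> f = g.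
Proof.
move=> /monicP f1 /monicP g1 fg gf.
have /eqp_eq : f %= g by rewrite /eqp fg.
by rewrite f1 g1 !scale1r.
Qed.

Section Admissible.
Context {k : fieldType} {G : groupType}.
Context {chi : {multiplicative G -> funit k}} (c : Z1 chi).
Implicit Types (f g : {poly k}) (u v : G).

Definition admissible f : Prop := f = 0 \/ (f \is monic /\ semi_invariant c f).

Lemma admissible_comp f u :
  admissible f -> exists a, f \Po aff_poly (Phi c u) = a *: f.
Proof.
case=> [->|[_ /(_ u)[a _ ->]]]; last by exists a.
by exists 0; rewrite comp_poly0 scaler0.
Qed.

Lemma admissible_dvd_antisym f g :
  admissible f -> admissible g -> f %| g -> g %| f -> f = g.
Proof.
move=> af ag fg gf; have [f0|f0] := eqVneq f 0.
  by move: fg; rewrite f0 dvd0p => /eqP->.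
have g0 : g != 0 by apply: contra f0 => /eqP g0; rewrite -dvd0p -g0.
case: af ag => [/eqP|[mf _]]; first by rewrite (negPf f0).
case=> [/eqP|[mg _]]; first by rewrite (negPf g0).
exact: monic_dvdp_antisym.
Qed.

(** Substituting a polynomial of degree 1 preserves the degree, so divisibility
    of f o phi_u by f is already proportionality. *)
Lemma admissible_dvdp_comp f :
    f = 0 \/ f \is monic ->
    (forall u, f %| f \Po aff_poly (Phi c u)) -> admissible f.
Proof.
case=> [->|mf] df; first by left.
right; split=> // u; have f0 := monic_neq0 mf.
have : f %= f \Po aff_poly (Phi c u).
  by rewrite -dvdp_size_eqp // size_comp_poly2 ?size_aff_poly.
case/eqpP=> -[a b] /= /andP[a0 b0] eq_ab; exists (b^-1 * a).
  by rewrite mulf_neq0 // invr_eq0.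
by rewrite -scalerA eq_ab scalerA mulVf // scale1r.
Qed.

Lemma invariant_ideal_principal (J : set {poly k}) :
    J 0 -> (forall f g, J f -> J g -> J (f - g)) ->
    (forall g f, J f -> J (g * f)) ->
    (forall u f, J f -> J (f \Po aff_poly (Phi c u))) ->
  exists2 f, admissible f & forall g, J g <-> f %| g.
Proof.
move=> J0 JB JM Jphi; have [f [f01 Jf]] := poly_ideal_principal J0 JB JM.
exists f => //; apply: admissible_dvdp_comp => // u.
by apply/Jf/Jphi/Jf.
Qed.

End Admissible.

(** * Two-sided ideals of a skew group ring *)

Lemma smallest_two_sided_ideal (B : nzRingType) (S : set B) :
  two_sided_ideal (smallest two_sided_ideal S).
Proof.
split=> [I [[]]//|x y Ix Iy I IS|a x Ix].
  by have [[_ IB _] _] := IS; apply: IB; [exact: Ix|exact: Iy].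
by split=> I IS; have [[_ _ IM] _] := IS; have [] := IM a _ (Ix I IS).
Qed.

Section SkewIdeals.
Context {k : fieldType} {G : groupType}.
Context {chi : {multiplicative G -> funit k}} (c : Z1 chi).
Context {B : nzRingType} (e : G -> B) (ev : {rmorphism {poly k} -> B}).
Context (R : skew_relations c e ev) (coords : B -> {malg {poly k}[G]}).
Context (combineK : cancel (combine e ev) coords).
Context (coordsK : cancel coords (combine e ev)).
Implicit Types (x y : B) (f g : {poly k}) (u v w : G).
Local Notation mon := (mon e ev).

Lemma mon_span (P : B -> Prop) :
  P 0 -> (forall x y, P x -> P y -> P (x + y)) -> (forall u f, P (mon u f)) ->
  forall x, P x.
Proof.
move=> P0 PD PM x; rewrite -(coordsK x) /combine /mlift.
by elim/big_ind: _ => // u _; exact: PM.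
Qed.

Lemma coords0 : coords 0 = 0.
Proof. by rewrite -[0 in LHS](combine0 e ev) combineK. Qed.

Lemma coordsD x y : coords (x + y) = coords x + coords y.
Proof. by rewrite -{1}(coordsK x) -{1}(coordsK y) -combineD combineK. Qed.

Lemma coordsB x y : coords (x - y) = coords x - coords y.
Proof. by rewrite -{1}(coordsK x) -{1}(coordsK y) -combineB combineK. Qed.

Lemma coords_mon u f : coords (mon u f) = << f *g u >>.
Proof. by rewrite -combineU combineK. Qed.

Lemma coords_eq0 x : coords x = 0 -> x = 0.
Proof. by move=> x0; rewrite -(coordsK x) x0 combine0. Qed.

(** Left multiplication by f(s) twists f by phi_u on the component of u, right
    multiplication does not: comparing the two is the key to
    [ideal_meets_ev]. *)
Lemma coords_ev_mul f x u :
  (coords (ev f * x))@_u = (f \Po aff_poly (Phi c u)) * (coords x)@_u.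
Proof.
move: x; apply: mon_span => [|x y hx hy|v g].
- by rewrite mulr0 coords0 mcoeff0 mulr0.
- by rewrite mulrDr !coordsD !mcoeffD mulrDr hx hy.
rewrite -(mon1 R) (monM R) !coords_mon !mcoeffU mul1g.
by case: eqP => [->|_]; rewrite ?mulr0.
Qed.

Lemma coords_mul_ev f x u : (coords (x * ev f))@_u = (coords x)@_u * f.
Proof.
move: x; apply: mon_span => [|x y hx hy|v g].
- by rewrite mul0r coords0 mcoeff0 mul0r.
- by rewrite mulrDl !coordsD !mcoeffD mulrDl hx hy.
by rewrite /mon -mulrA -rmorphM !coords_mon !mcoeffU mulrnAl.
Qed.

Lemma coords_ev f : (coords (ev f))@_1%g = f.
Proof. by rewrite -(mon1 R) coords_mon mcoeffUU. Qed.

Lemma lprincipal_ev_dvd f g : lprincipal (ev f) (ev g) <-> f %| g.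
Proof.
split=> [[a _ eg]|/dvdpP[q ->]]; last by exists (ev q) => //; rewrite rmorphM.
by rewrite -(coords_ev g) -eg coords_mul_ev dvdp_mull.
Qed.

Lemma lprincipal_ev_inj f g : admissible c f -> admissible c g ->
  lprincipal (ev f) = lprincipal (ev g) -> f = g.
Proof.
move=> af ag fg; apply: (admissible_dvd_antisym af ag).
  by apply/lprincipal_ev_dvd; rewrite fg; apply/lprincipal_ev_dvd.
by apply/lprincipal_ev_dvd; rewrite -fg; apply/lprincipal_ev_dvd.
Qed.

(** Semi-invariance lets f(s) move past any element: f(s) u is a scalar
    multiple of u f(s). *)
Lemma lprincipal_ev_ideal f :
  admissible c f -> two_sided_ideal (lprincipal (ev f)).
Proof.
move=> af; have IB x y : lprincipal (ev f) x -> lprincipal (ev f) y ->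
    lprincipal (ev f) (x - y).
  by move=> [a _ <-] [b _ <-]; exists (a - b); rewrite // mulrBl.
have I0 : lprincipal (ev f) 0 by exists 0; rewrite // mul0r.
split=> // a _ [b _ <-]; split; first by exists (a * b); rewrite // mulrA.
move: a; apply: mon_span => [|x y hx hy|u g]; first by rewrite mulr0.
  rewrite mulrDr -[_ * y]opprK; apply: (IB _ _) => //.
  by rewrite -sub0r; exact: IB.
have [d fd] := admissible_comp u af.
exists (b * mon u (d *: g)) => //.
rewrite -[LHS]mulrA -[RHS]mulrA; congr (b * _).
rewrite -(mon1 R) !(monM R) mulg1 mul1g fd Phi1 comp_aff_poly1.
by rewrite -!scalerAl mulrC.
Qed.

(** The trace on k[X] of a two-sided ideal is stable under substitution by
    phi_u because this substitution is conjugation by u. *)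
Lemma ideal_ev_principal (I : set B) : two_sided_ideal I ->
  exists2 f, admissible c f & forall g, I (ev g) <-> f %| g.
Proof.
case=> I0 IB IM.
apply: (invariant_ideal_principal (J := fun g => I (ev g))).
- by rewrite rmorph0.
- by move=> f g If Ig; rewrite rmorphB; exact: IB.
- by move=> g f If; rewrite rmorphM; have [] := IM (ev g) _ If.
move=> u f If.
have -> : ev (f \Po aff_poly (Phi c u)) = e u^-1%g * (ev f * e u).
  by rewrite (skew_e R) mulrA (skew_eM R) mulVg (skew_e1 R) mul1r.
by have [_ /(IM (e u^-1%g))[]] := IM (e u) _ If.
Qed.

Section Graded.
Context (gr : G -> set B).
Context (gr_mon : forall u x, gr u x <-> exists f, x = mon u f).

Lemma graded_idealP (I : set B) : graded_ideal gr I <->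
  exists2 f, admissible c f & I = lprincipal (ev f).
Proof.
split=> [[S Sgr {I}->]|[f af ->]]; last first.
  exists [set ev f].
    by move=> _ ->; exists 1%g; apply/gr_mon; exists f; rewrite (mon1 R).
  apply/seteqP; split; last first.
    apply: smallest_sub; first exact: lprincipal_ev_ideal.
    by move=> _ ->; exists 1; rewrite // mul1r.
  move=> _ [a _ <-]; have [_ _ IM] := smallest_two_sided_ideal [set ev f].
  by have [] := IM a (ev f) (@sub_gen_smallest _ _ _ _ erefl).
have sI := smallest_two_sided_ideal S; set I := smallest _ _ in sI *.
have [f af If] := ideal_ev_principal sI; exists f => //.
have [_ _ IM] := sI.
have IL : lprincipal (ev f) `<=` I.
  by move=> _ [a _ <-]; have [] := IM a (ev f) (proj2 (If f) (dvdpp f)).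
apply/seteqP; split=> //; apply: smallest_sub; first exact: lprincipal_ev_ideal.
move=> x Sx; have [u /gr_mon[g xg]] := Sgr x Sx.
have Ix : I x by apply: sub_gen_smallest.
have /If fg : I (ev g).
  have [Ig _] := IM (e u^-1%g) _ Ix; move: Ig.
  by rewrite xg /mon mulrA (skew_eM R) mulVg (skew_e1 R) mul1r.
have /lprincipal_ev_dvd[a _ ag] := fg.
by exists (e u * a); rewrite // xg -mulrA ag.
Qed.

Lemma lprincipal_ev0 : lprincipal (ev 0) = [set 0].
Proof.
apply/seteqP; split=> [_ [a _ <-]|_ ->]; first by rewrite rmorph0 mulr0.
by exists 0; rewrite // mul0r.
Qed.

Lemma lprincipal_ev1 : lprincipal (ev 1) = setT.
Proof. by apply/seteqP; split=> // x _; exists x; rewrite // rmorph1 mulr1. Qed.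

Lemma gr_simpleP :
  gr_simple gr <-> forall f, f \is monic -> semi_invariant c f -> f = 1.
Proof.
have a0 : admissible c 0 by left.
have a1 : admissible c 1.
  right; split=> [|u]; first exact: monic1.
  by exists 1; rewrite ?oner_neq0 // comp_polyC scale1r.
split=> [simp f mf sf|only1 I /graded_idealP[f [->|[mf sf]] ->]].
- have af : admissible c f by right.
  have /simp[] : graded_ideal gr (lprincipal (ev f)).
    by apply/graded_idealP; exists f.
  + rewrite -lprincipal_ev0 => /lprincipal_ev_inj -/(_ af a0) f0.
    by move: (monic_neq0 mf); rewrite f0 eqxx.
  by rewrite -lprincipal_ev1 => /lprincipal_ev_inj -> .
- by left; exact: lprincipal_ev0.
by right; rewrite (only1 f) // lprincipal_ev1.
Qed.

Lemma simple_gr_simple : simple_ring B -> gr_simple gr.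
Proof.
by move=> simp I [S _ ->]; apply: simp; exact: smallest_two_sided_ideal.
Qed.

End Graded.

(** The right action of the skew group ring on k[X] in which u acts by
    p |-> p o phi_u and f(s) by multiplication by f. It is defined on
    coordinates; that it is an action is [poly_actM]. *)
Definition poly_act (p : {poly k}) (x : B) : {poly k} :=
  mlift (fun u => p \Po aff_poly (Phi c u) : {poly k}^o) (coords x).

Lemma poly_act_mon p u f :
  poly_act p (mon u f) = f * (p \Po aff_poly (Phi c u)).
Proof. by rewrite /poly_act coords_mon mliftU. Qed.

Lemma poly_actDr p : {morph poly_act p : x y / x + y}.
Proof. by move=> x y; rewrite /poly_act coordsD linearD. Qed.

Lemma poly_act0r p : poly_act p 0 = 0.
Proof. by rewrite /poly_act coords0 linear0. Qed.

Lemma poly_actBr p : {morph poly_act p : x y / x - y}.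
Proof. by move=> x y; rewrite /poly_act coordsB linearB. Qed.

Lemma poly_actDl p q x : poly_act (p + q) x = poly_act p x + poly_act q x.
Proof.
rewrite /poly_act /mlift -big_split; apply: eq_bigr => u _ /=.
by rewrite comp_polyD scalerDr.
Qed.

Lemma poly_act0l x : poly_act 0 x = 0.
Proof.
by rewrite /poly_act /mlift big1 // => u _; rewrite comp_poly0 scaler0.
Qed.

Lemma poly_actM p x y : poly_act p (x * y) = poly_act (poly_act p x) y.
Proof.
move: x; apply: mon_span => [|x1 x2 h1 h2|u f].
- by rewrite mul0r !poly_act0r poly_act0l.
- by rewrite mulrDl !poly_actDr poly_actDl h1 h2.
move: y; apply: mon_span => [|y1 y2 h1 h2|v g].
- by rewrite mulr0 !poly_act0r.
- by rewrite mulrDr !poly_actDr h1 h2.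
rewrite (monM R) !poly_act_mon comp_polyM Phi_is_multiplicative aff_polyM.
by rewrite comp_polyA mulrAC mulrC.
Qed.

(** The annihilator of k[X] is a two-sided ideal which contains e u - e v as
    soon as u and v define the same affine map. *)
Lemma simple_Phi_inj : simple_ring B -> injective (Phi c).
Proof.
move=> simp u v Puv.
pose I : set B := [set x | forall p, poly_act p x = 0].
have : two_sided_ideal I.
  split=> [p|x y Ix Iy p|a x Ix]; first exact: poly_act0r.
    by rewrite poly_actBr Ix Iy subrr.
  by split=> p; rewrite poly_actM Ix ?poly_act0l.
have Iuv : I (mon u 1 - mon v 1).
  by move=> p; rewrite poly_actBr !poly_act_mon Puv subrr.
move/simp=> [I0|IT].
  move: Iuv; rewrite I0 => /eqP; rewrite subr_eq0 => /eqP.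
  move=> /(congr1 (fun x => (coords x)@_u)).
  rewrite !coords_mon mcoeffUU mcoeffU.
  by case: (v =P u) => // _ /eqP; rewrite oner_eq0.
have : I (mon 1%g 1) by rewrite IT.
move=> /(_ 1); rewrite poly_act_mon mul1r comp_polyC => /eqP.
by rewrite oner_eq0.
Qed.

(** Induction on the size of the support of x. For u in the support, z below has
    coordinates (phi_{u^-1 v} - X) x_v: it vanishes at v = u, and by
    injectivity of Phi nowhere else on the support. Once no shortening is
    possible, x = u f(s). *)
Lemma ideal_meets_ev (I : set B) x : injective (Phi c) ->
  two_sided_ideal I -> I x -> x != 0 -> exists2 f : {poly k}, f != 0 & I (ev f).
Proof.
move=> inj [I0 IB IM].
have [n] := ubnP #|` msupp (coords x)|; elim: n x => // n IHn x szx Ix x0.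
have [u ux] : exists u, u \in msupp (coords x).
  have [sx0|[u ux]] := fset_0Vmem (msupp (coords x)); last by exists u.
  case/eqP: x0; apply: coords_eq0; apply/malgP => u.
  by rewrite mcoeff0 mcoeff_outdom // sx0.
(* The first factor is u s u^-1. *)
pose z := ev (aff_poly (Phi c u^-1%g)) * x - x * ev 'X.
have Iz : I z.
  have [Ilx _] := IM (ev (aff_poly (Phi c u^-1%g))) x Ix.
  by have [_ Ixr] := IM (ev 'X) x Ix; exact: IB.
have zE v :
    (coords z)@_v = (aff_poly (Phi c (u^-1 * v)%g) - 'X) * (coords x)@_v.
  rewrite coordsB mcoeffB coords_ev_mul coords_mul_ev.
  by rewrite Phi_is_multiplicative aff_polyM mulrBl (mulrC 'X).
have zu : (coords z)@_u = 0.
  by rewrite zE mulVg Phi1 aff_poly1 subrr mul0r.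
have [z0|z0] := eqVneq z 0; last first.
  apply: IHn Iz z0; apply: leq_trans (_ : #|` msupp (coords x)| <= n)%N => //.
  apply: fproper_ltn_card; rewrite fproperEneq; apply/andP; split.
    by apply: contraTneq ux => <-; rewrite -mcoeff_neq0 zu eqxx.
  apply/fsubsetP => v; rewrite -!mcoeff_neq0 zE; apply: contra => /eqP->.
  by rewrite mulr0.
have only v : v != u -> (coords x)@_v = 0.
  move=> vu; apply/eqP; move: (zE v); rewrite z0 coords0 mcoeff0 => /esym/eqP.
  rewrite mulf_eq0 => /orP[|//]; rewrite subr_eq0 -aff_poly1 -(Phi1 c).
  move/eqP/aff_poly_inj/inj => uv1.
  by case/eqP: vu; rewrite -(mulVKg u v) uv1 mulg1.
exists (coords x)@_u; first by rewrite mcoeff_neq0.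
have xE : x = mon u (coords x)@_u.
  apply: (can_inj coordsK); rewrite coords_mon; apply/malgP => v.
  by rewrite mcoeffU; have [->//|uv] := eqVneq u v; rewrite only // eq_sym.
have [Ie _] := IM (e u^-1%g) x Ix; move: Ie.
by rewrite {1}xE /mon mulrA (skew_eM R) mulVg (skew_e1 R) mul1r.
Qed.

Lemma simple_ringP (gr : G -> set B) :
    (forall u x, gr u x <-> exists f, x = mon u f) ->
  (simple_ring B <-> gr_simple gr /\ injective (Phi c)).
Proof.
move=> gr_mon; split=> [simp|[/(gr_simpleP gr_mon) only1 inj] I sI].
  by split; [exact: simple_gr_simple|exact: simple_Phi_inj].
have [I0 IB IM] := sI.
have [[x [x0 Ix]]|noI] := pselect (exists x, x != 0 /\ I x); last first.
  left; apply/seteqP; split=> [x Ix|_ ->] //=.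
  by apply: contrapT => /eqP x0; apply: noI; exists x.
have [g g0 Ig] := ideal_meets_ev inj sI Ix x0.
have [f af If] := ideal_ev_principal sI.
right; apply/seteqP; split=> // y _.
have f1 : f = 1.
  case: af => [f0|[mf sf]]; last exact: only1.
  by move/If: Ig; rewrite f0 dvd0p (negPf g0).
have I1 : I (ev 1) by apply/If; rewrite f1.
by have [] := IM y _ I1; rewrite rmorph1 mulr1.
Qed.

End SkewIdeals.

(** * Injectivity of Phi makes G metabelian *)

Definition closed_subgroup (G : groupType) (S : {pred G}) (S1 : 1%g \in S)
    (SM : mulg_closed S) (SV : invg_closed S) : groupClosed G :=
  GroupClosed.Pack (GroupClosed.Class
    (@isInvClosed.Axioms_ G S SV) (@isMul1Closed.Axioms_ G S S1)
    (@isMulClosed.Axioms_ G S SM)).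

Section Metabelian.
Context {k : fieldType} {G : groupType}.
Context (chi : {multiplicative G -> funit k}).

Definition char_ker : {pred G} := [pred u | chi u == 1%g].

Lemma char_ker_inv : invg_closed char_ker.
Proof.
move=> u; rewrite !inE => /eqP u1; apply/eqP/(mulgI (chi u)).
by rewrite -gmulfM mulgV char_at1 u1 mulg1.
Qed.
Lemma char_ker_1 : 1%g \in char_ker.
Proof. by rewrite inE char_at1. Qed.
Lemma char_ker_mul : mulg_closed char_ker.
Proof.
by move=> u v; rewrite !inE gmulfM => /eqP -> /eqP ->; rewrite mulg1.
Qed.

Lemma char_mulC u v : chi (u * v)%g = chi (v * u)%g.
Proof. by apply: val_inj; rewrite !gmulfM /= mulrC. Qed.

(** The kernel of chi is abelian since Phi sends it to translations; the
    quotient is abelian since chi has commutative values. *)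
Lemma Phi_inj_metabelian (c : Z1 chi) : injective (Phi c) -> metabelian G.
Proof.
pose H := closed_subgroup char_ker_1 char_ker_mul char_ker_inv.
move=> inj; exists H; split.
- move=> u v; rewrite !inE => /eqP u1 /eqP v1; apply: inj.
  rewrite !Phi_is_multiplicative; congr Aff => /=; rewrite u1 v1 //.
  by rewrite !mul1r addrC.
- move=> u v; rewrite !inE => /eqP u1; rewrite /conjg char_mulC.
  by rewrite mulgK u1.
move=> u v; apply/seteqP.
have K x y : lcoset H (x * y)%g `<=` lcoset H (y * x)%g.
  move=> _ [h hK <-].
  exists ((y * x)^-1 * (x * y * h))%g; last by rewrite mulVKg.
  apply/eqP; rewrite [LHS]gmulfM [X in (_ * X)%g]gmulfM (eqP hK) mulg1.
  rewrite (char_mulC x).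
  by rewrite -gmulfM mulVg char_at1.
by split; exact: K.
Qed.

End Metabelian.

(** * Finite orbits, fixed points and cohomology *)

Section Orbits.
Context {k : fieldType} {kbar : closedFieldType} (iota : {rmorphism k -> kbar}).
Implicit Types (p q : aff k) (x y : kbar) (f g : {poly k}).

Lemma aff_actM p q x :
  aff_act iota (p * q)%g x = aff_act iota p (aff_act iota q x).
Proof. by rewrite /aff_act /= rmorphD !rmorphM mulrDr mulrA addrA. Qed.

Lemma aff_act1 x : aff_act iota 1%g x = x.
Proof. by rewrite /aff_act /= rmorph1 rmorph0 mul1r addr0. Qed.

Lemma aff_act_inj p : injective (aff_act iota p).
Proof.
move=> x y /(congr1 (aff_act iota p^-1%g)).
by rewrite -!aff_actM mulVg !aff_act1.
Qed.

Lemma horner_comp_aff f p x :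
  (map_poly iota (f \Po aff_poly p)).[x] = (map_poly iota f).[aff_act iota p x].
Proof.
rewrite map_comp_poly horner_comp; congr (_.[_]).
by rewrite /aff_poly rmorphD /= map_polyZ map_polyX map_polyC /= !hornerE.
Qed.

Lemma finite_roots f : f != 0 -> finite_set [set x | root (map_poly iota f) x].
Proof.
move=> f0; have [r fr] := closed_field_poly_normal (map_poly iota f).
apply: sub_finite_set (finite_seq r) => x /=.
by rewrite fr rootZ ?root_prod_XsubC // lead_coef_eq0 map_poly_eq0.
Qed.

Context {G : groupType} {chi : {multiplicative G -> funit k}} (c : Z1 chi).
Implicit Types (u v : G).
Local Notation act u := (aff_act iota (Phi c u)).
Local Notation orbit x := (aff_orbit iota (range (Phi c)) x).

Lemma PhiM u v : Phi c (u * v)%g = (Phi c u * Phi c v)%g.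
Proof. exact: Phi_is_multiplicative. Qed.

Lemma orbitP x y : orbit x y <-> exists u, act u x = y.
Proof.
split=> [[_ [u _ <-] <-]|[u <-]]; first by exists u.
by exists (Phi c u) => //; exists u.
Qed.

Lemma semi_invariant_finite_orbit f :
  f \is monic -> semi_invariant c f -> f <> 1 -> exists x, finite_set (orbit x).
Proof.
move=> mf sf f1.
have /closed_rootP[x fx] : size (map_poly iota f) != 1.
  rewrite size_map_poly; apply/eqP => /eqP/size_poly1P[a a0 fa].
  by apply: f1; move: mf; rewrite fa monicE lead_coefC => /eqP->.
exists x; apply: sub_finite_set (finite_roots (monic_neq0 mf)).
move=> _ /orbitP[u <-] /=.
have [a _ fu] := sf u.
rewrite /root -horner_comp_aff fu map_polyZ hornerZ (rootP fx).
by rewrite mulr0.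
Qed.

Lemma finite_set_annihilator (S : set kbar) :
  algebraic_closure iota -> finite_set S ->
  exists2 f, f != 0 & forall x, S x -> root (map_poly iota f) x.
Proof.
move=> alg /finite_seqP[r ->].
elim: r => [|y r [f f0 fr]]; first by exists 1; rewrite ?oner_neq0.
have [h h0 hy] := alg y; exists (h * f); first by rewrite mulf_neq0.
move=> x /=; rewrite inE rmorphM rootM => /orP[/eqP->|/fr->]; last exact: orbT.
by rewrite hy.
Qed.

(** Vanishing on the whole orbit is imposed on polynomials over k, rather than
    forming the product of the X - y over the orbit, whose coefficients need
    not lie in k. *)
Lemma finite_orbit_semi_invariant x :
    algebraic_closure iota -> finite_set (orbit x) ->
  exists f, [/\ f \is monic, semi_invariant c f & f <> 1].
Proof.
move=> alg /(finite_set_annihilator alg)[h h0 hx].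
pose J : set {poly k} := [set f | forall u, root (map_poly iota f) (act u x)].
have [|f g Jf Jg u|g f Jf u|v f Jf u|f af Jf] :=
    @invariant_ideal_principal _ _ _ c J.
- by move=> u; rewrite rmorph0 root0.
- by rewrite rmorphB /root hornerD hornerN !(rootP (Jf _), rootP (Jg _)) subrr.
- by rewrite rmorphM rootM Jf orbT.
- by rewrite /root horner_comp_aff -aff_actM -PhiM; exact: Jf.
exists f; case: af => [f0|[mf sf]].
  have : J h by move=> u; apply/hx/orbitP; exists u.
  by move/Jf; rewrite f0 dvd0p (negPf h0).
split=> // f1; have : J f by apply/Jf.
by rewrite f1 => /(_ 1%g); rewrite rmorph1 (negPf (root1 _)).
Qed.

Lemma no_finite_orbitP : algebraic_closure iota ->
  (forall f, f \is monic -> semi_invariant c f -> f = 1) <->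
  (forall x, ~ finite_set (orbit x)).
Proof.
move=> alg; split=> [only1 x fin|inf f mf sf].
  have [f [mf sf]] := finite_orbit_semi_invariant alg fin.
  by apply; exact: only1.
apply: contrapT => f1.
by have [x /inf] := semi_invariant_finite_orbit mf sf f1.
Qed.

(** A fixed point satisfies c(u) = x (1 - chi(u)). If some chi(u) differs
    from 1 this equation puts x in k; if not, c = 0. *)
Lemma fixed_point_H1 x : (forall u, act u x = x) -> H1_class c = 0.
Proof.
move=> fx; apply/H1_class_eq0/asboolP.
have cE u : iota (c u) = x * (1 - iota (funit_val (chi u))).
  rewrite mulrBr mulr1 -[X in X - _](fx u) /aff_act /= mulrC.
  by rewrite addrAC subrr add0r.
have [[u u1]|all1] := pselect (exists u, funit_val (chi u) != 1); last first.
  exists 0 => u; rewrite mul0r; apply: (fmorph_inj iota).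
  rewrite cE rmorph0; have -> : funit_val (chi u) = 1.
    by apply: contrapT => /eqP u1; apply: all1; exists u.
  by rewrite rmorph1 subrr mulr0.
have d0 : 1 - funit_val (chi u) != 0 by rewrite subr_eq0 eq_sym.
have [y xy] : exists y : k, x = iota y.
  exists (c u / (1 - funit_val (chi u))).
  rewrite rmorphM fmorphV cE rmorphB rmorph1 mulfK //.
  by rewrite -(rmorph1 iota) -rmorphB fmorph_eq0.
exists (- y) => v; apply: (fmorph_inj iota).
by rewrite cE xy mulNr -mulrN opprB rmorphM rmorphB rmorph1.
Qed.

Lemma H1_fixed_point : H1_class c = 0 -> exists x, forall u, act u x = x.
Proof.
move/H1_class_eq0/asboolP => [y cy]; exists (iota (- y)) => u.
rewrite /aff_act /= cy -rmorphM -rmorphD; congr (iota _).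
by rewrite mulrBr mulr1 mulrN mulrC addKr.
Qed.

Lemma fixed_orbit x : (forall u, act u x = x) -> finite_set (orbit x).
Proof.
move=> fx; apply: sub_finite_set (finite_set1 x) => _ /orbitP[u <-].
exact: fx.
Qed.

Lemma stabilizer_finite_index x : finite_set (orbit x) ->
  exists2 H : groupClosed G, finite_index H & forall u, u \in H -> act u x = x.
Proof.
move=> fin; pose S : {pred G} := [pred u | act u x == x].
have S1 : 1%g \in S by rewrite inE Phi1 aff_act1.
have SM : mulg_closed S.
  by move=> u v; rewrite !inE PhiM aff_actM => /eqP ux /eqP ->; rewrite ux.
have SV : invg_closed S.
  move=> u; rewrite !inE => /eqP ux.
  by rewrite -{1}ux -aff_actM -PhiM mulVg Phi1 aff_act1.
exists (closed_subgroup S1 SM SV) => [|u]; last by rewrite inE => /eqP.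
have cosetE u :
    lcoset (closed_subgroup S1 SM SV) u = [set v | act v x = act u x].
  apply/seteqP; split=> [_ [h /eqP hx <-]|v /= vu].
    by rewrite /= PhiM aff_actM hx.
  exists (u^-1 * v)%g; last by rewrite mulVKg.
  by apply/eqP; rewrite PhiM aff_actM vu -aff_actM -PhiM mulVg Phi1 aff_act1.
apply: sub_finite_set (finite_image (fun y => [set v | act v x = y]) fin).
move=> _ [u _ <-]; rewrite cosetE; exists (act u x) => //.
by apply/orbitP; exists u.
Qed.

Lemma finite_index_finite_orbit (H : groupClosed G) x :
  finite_index H -> (forall u, u \in H -> act u x = x) -> finite_set (orbit x).
Proof.
move=> fin Hx.
apply: sub_finite_set (finite_image (fun C => act (xget 1%g C) x) fin).
move=> _ /orbitP[u <-]; exists (lcoset H u); first by exists u.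
case: xgetP => [_ -> [h hH <-]|/(_ u)[]]; first by rewrite PhiM aff_actM Hx.
by exists 1%g; rewrite ?mulg1 //; exact: gpred1.
Qed.

(** Affine maps commute with taking means, and each of them permutes the
    orbit. *)
Lemma char0_fixed_point x : [pchar k] =i pred0 -> finite_set (orbit x) ->
  exists y, forall u, act u y = y.
Proof.
move=> k0 fin; pose r := fset_set (orbit x).
have rP y : y \in r -> exists u, act u x = y.
  by rewrite in_fset_set // inE => /orbitP.
have n0 : (size r)%:R != 0 :> kbar.
  have /pcharf0P -> : [pchar kbar] =i pred0.
    by move=> p; rewrite (fmorph_pchar iota) k0.
  have : x \in r.
    rewrite in_fset_set // inE; apply/orbitP; exists 1%g.
    by rewrite Phi1 aff_act1.
  move=> xr; rewrite -lt0n (leq_ltn_trans _ (_ : index x r < _))%N //.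
  by rewrite index_mem.
have sumE u : \sum_(y <- r) act u y = \sum_(y <- r) y.
  rewrite -(big_map (act u) predT id); apply: perm_big; apply: uniq_perm => //.
  - by rewrite (map_inj_uniq (@aff_act_inj _)) fset_uniq.
  - exact: fset_uniq.
  apply: (uniq_min_size _ _ _).2; rewrite ?size_map //.
    by rewrite (map_inj_uniq (@aff_act_inj _)) fset_uniq.
  move=> _ /mapP[y /rP[v <-] ->]; rewrite -aff_actM -PhiM in_fset_set // inE.
  by apply/orbitP; exists (u * v)%g.
(* The mean of the orbit, which makes sense as its size is invertible. *)
exists ((\sum_(y <- r) y) / (size r)%:R) => u.
apply: (mulIf n0); rewrite mulfVK // -[RHS](sumE u) /aff_act /= big_split /=.
rewrite -mulr_sumr mulrDl -mulrA mulfVK //; congr (_ + _).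
by rewrite big_const_seq count_predT iter_addr_0 mulr_natr.
Qed.

End Orbits.

(** * The graded ideals and the simplicity of A *)

Theorem theorem3p19 (k : fieldType) (kbar : closedFieldType)
    (iota : {rmorphism k -> kbar}) (kbar_closure : algebraic_closure iota)
    (G : groupType) (gamma : G) (chi : {multiplicative G -> funit k})
    (c : Z1 chi) :
  let A := ore (delta gamma c) in
  let gr : G -> set A := Agrading gamma c in
  let admissible f := f = 0 \/ (f \is monic /\ semi_invariant c f) in
  let ideal_of f : set A := lprincipal (evalA gamma c f) in
  [/\ (forall I : set A, graded_ideal gr I <->
         exists2 f, admissible f & I = ideal_of f) /\
      (forall f g, admissible f -> admissible g ->
         ideal_of f = ideal_of g -> f = g),
      (gr_simple gr <->
         forall x : kbar, ~ finite_set (aff_orbit iota (range (Phi c)) x)) /\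
      (gr_simple gr <->
         forall H : groupClosed G, finite_index H ->
           H1_class (res_Z1 H c) <> 0),
      ([pchar k] =i pred0 -> (gr_simple gr <-> H1_class c <> 0))
    & (simple_ring A <-> gr_simple gr /\ injective (Phi c)) /\
      (simple_ring A -> metabelian G)].
Proof.
move=> A gr ideal_adm ideal_of.
have R := evalA_skew gamma c.
have [coords combineK coordsK] :
    bijective (combine (gelt gamma c) (evalA gamma c)).
  have inv x : {z | combine (gelt gamma c) (evalA gamma c) z = x}.
    exact/cid/combine_surj.
  exists (fun x => sval (inv x)) => [z|x]; last exact: svalP (inv x).
  by apply: (@combine_inj _ _ gamma _ c); exact: svalP (inv _).
have gr_mon u x :
    gr u x <-> exists f, x = mon (gelt gamma c) (evalA gamma c) u f.
  by split=> [/Agrading_mon//|[f ->]]; exact: mon_Agrading.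
have orbits : gr_simple gr <->
    forall x : kbar, ~ finite_set (aff_orbit iota (range (Phi c)) x).
  rewrite -no_finite_orbitP //; exact: gr_simpleP R _ combineK coordsK _ gr_mon.
split.
- split; first exact: graded_idealP R _ combineK coordsK _ gr_mon.
  exact: lprincipal_ev_inj R _ combineK coordsK.
- split=> //; rewrite orbits; split=> [inf H finH|res0 x fin].
    move/(H1_fixed_point iota) => [x Hx]; apply: (inf x).
    apply: finite_index_finite_orbit finH _ => u uH; exact: (Hx (MkSubgrp uH)).
  have [H finH Hx] := stabilizer_finite_index fin; apply: (res0 H finH).
  by apply: (@fixed_point_H1 _ _ iota _ _ _ x) => -[u uH]; exact: Hx.
- move=> k0; rewrite orbits; split=> [inf|c0 x fin].
    by move/(H1_fixed_point iota) => [x /fixed_orbit/inf].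
  by have [y /fixed_point_H1/c0] := char0_fixed_point k0 fin.
have simpleP := simple_ringP R combineK coordsK gr_mon.
split=> // /simpleP[_]; exact: Phi_inj_metabelian.
Qed.
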